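(* Let $\phi$ be a $C^2$-functional on $E$ such that $\phi'$ and $\phi''$ are $\alpha$-Hölder continuous on bounded sets for some $\alpha\in(0,1]$. Let $\mathcal{F}$ be a homotopic family of $S_\mu$ of dimension at most $n$ with boundary $B$, such that $$c:=\inf_{A\in\mathcal{F}}\max_{u\in A}\phi(u)>\max_B\phi$$ and $c$ is finite. Let $R>1$ and $0<\alpha_1\le\frac{\alpha}{2(\alpha+2)}<1$. Then there exists $\varepsilon_0>0$ such that for every $\varepsilon\in(0,\varepsilon_0)$ and for every $A\in\mathcal{F}$ with $\max_{u\in A}\phi(u)\le c+\varepsilon$ satisfying $$K:=\{u\in A:\phi(u)\ge c-\varepsilon\}\subset B(0,R-1),$$ there exists $u_\varepsilon\in S_\mu$ such that: 1. $c-\varepsilon\le\phi(u_\varepsilon)\le c+\varepsilon$; 2. $\|\phi'|_{S_\mu}(u_\varepsilon)\|_*\le3\varepsilon^{\alpha_1}$; 3. $u_\varepsilon\in A$; 4. if $W$ is a subspace of $T_{u_\varepsilon}S_\mu$ such that $D^2\phi(u_\varepsilon)[w,w]<-\varepsilon^{\alpha_1}\|w\|^2$ for all $w\in W$, $w\neq0$, then $\dim W\le n$.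
   Context: Setting. $(E,\langle\cdot,\cdot\rangle)$ and $(H,(\cdot,\cdot))$ are infinite-dimensional real Hilbert spaces with continuous injections $E\hookrightarrow H\hookrightarrow E'$; the injection $E\hookrightarrow H$ has norm at most $1$ and $E$ is identified with its image in $H$. Write $\|u\|^2=\langle u,u\rangle$ and $|u|^2=(u,u)$ for $u\in E$. For a fixed $\mu\in(0,+\infty)$, $S_\mu=\{u\in E: |u|^2=\mu\}$, a codimension-one submanifold of $E$ with tangent space $T_uS_\mu=\{v\in E:(u,v)=0\}$ at $u\in S_\mu$; $S_\mu$ carries the topology induced from $E$. $B(0,r)$ is the ball of radius $r$ of $(E,\|\cdot\|)$. $\|\cdot\|_*$ and $\|\cdot\|_{**}$ denote the operator norms of $\mathcal{L}(E,\mathbb{R})$ and $\mathcal{L}(E,\mathcal{L}(E,\mathbb{R}))$. For $u\in S_\mu$, $\phi'|_{S_\mu}(u)$ denotes the differential at $u$ of the restriction of $\phi$ to $S_\mu$, a linear form on $T_uS_\mu$, and $\|\phi'|_{S_\mu}(u)\|_*$ is its dual norm with respect to the norm $\|\cdot\|$ on $T_uS_\mu$ inherited from $E$. For a $C^2$ functional $\phi$ on $E$ and $\alpha\in(0,1]$, $\phi'$ and $\phi''$ are $\alpha$-Hölder continuous on bounded sets if for any $R>0$ there is $M=M(R)>0$ such that for all $u_1,u_2\in B(0,R)$: $\|\phi'(u_1)-\phi'(u_2)\|_*\le M\|u_1-u_2\|^\alpha$ and $\|\phi''(u_1)-\phi''(u_2)\|_{**}\le M\|u_1-u_2\|^\alpha$.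 For $u\in E\setminus\{0\}$, $D^2\phi(u)$ is the continuous bilinear form $D^2\phi(u)=\phi''(u)-\frac{\phi'(u)\cdot u}{|u|^2}(\cdot,\cdot)$. A family $\mathcal{F}$ of subsets of $S_\mu$ is homotopic of dimension at most $n$ with boundary $B$ if there exist a compact subset $D$ of $\mathbb{R}^n$, containing a closed subset $D_0$, and a continuous function $\eta_0$ from $D_0$ onto $B$ such that $\mathcal{F}=\{A\subset S_\mu : A=f(D)\text{ for some } f\in C(D;S_\mu)\text{ with } f=\eta_0\text{ on }D_0\}$. *)

(* Defs.v *)
From HB Require Import structures.
From mathcomp Require Import all_boot all_order all_algebra.
From mathcomp Require Import sesquilinear.
From mathcomp Require Import all_classical all_reals all_analysis.

Set Implicit Arguments.
Unset Strict Implicit.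
Unset Printing Implicit Defensive.

Import Order.TTheory GRing.Theory Num.Theory.
Import numFieldNormedType.Exports.

Local Open Scope classical_set_scope.
Local Open Scope ring_scope.

(* Norm of (the restriction to T of) a linear map f, for a subspace T. *)
Definition norm_on (R : realType) (V W : normedModType R) (T : set V)
    (f : V -> W) : R :=
  sup [set `|f v| | v in T `&` [set v | `|v| <= 1]].

(* The normed space L(V, W) of continuous linear maps. *)
Section ContinuousLinear.
Context {R : realType} {V W : normedModType R}.

Definition is_clin : {pred V -> W} :=
  [pred f : V -> W | `[< linear f /\ continuous f >]].

Lemma is_clin_submod_closed : submod_closed is_clin.
Proof.
split=> [|a f g].
- apply/asboolP; split=> [k u v|]; first by rewrite /= scaler0 addr0.
  exact: cst_continuous.
- move=> /asboolP[lf cf] /asboolP[lg cg]; apply/asboolP; split=> [k u v|x].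
    rewrite !fctE lf lg !scalerDr !scalerA (mulrC a k).
    by rewrite -!addrA; congr (_ + _); rewrite addrCA.
  by apply: cvgD; [apply: cvgZl_tmp; exact: cf|exact: cg].
Qed.

HB.instance Definition _ :=
  GRing.isSubmodClosed.Build R (V -> W) is_clin is_clin_submod_closed.

Record clin := CLin { clin_fun :> V -> W; _ : clin_fun \in is_clin }.

HB.instance Definition _ := [isSub for clin_fun].
HB.instance Definition _ := [Choice of clin by <:].
HB.instance Definition _ := [SubChoice_isSubLmodule of clin by <:].

Lemma clin_linear (f : clin) : linear f.
Proof. by case: f => f /= /asboolP[]. Qed.

Lemma clin_continuous (f : clin) : continuous f.
Proof. by case: f => f /= /asboolP[]. Qed.

HB.instance Definition _ (f : clin) :=
  GRing.isLinear.Build R V W _ f (clin_linear f).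

Definition opnorm (f : clin) : R := norm_on setT f.

Lemma opnorm_has_sup (f : clin) :
  has_sup [set `|f v| | v in setT `&` [set v | `|v| <= 1]].
Proof.
split; first by exists `|f 0|, 0 => //; split=> //=; rewrite normr0.
have /linear_bounded_continuous/bounded_funP/(_ 1)[M hM] := @clin_continuous f.
by exists M => _ [v [_ v1] <-]; exact: hM.
Qed.

Lemma opnorm_ge (f : clin) v : `|v| <= 1 -> `|f v| <= opnorm f.
Proof.
move=> v1; apply: ub_le_sup; first by case: (opnorm_has_sup f).
by exists v.
Qed.

Lemma opnorm_le (f : clin) M :
  (forall v, `|v| <= 1 -> `|f v| <= M) -> opnorm f <= M.
Proof.
move=> fM; apply: ge_sup; first by case: (opnorm_has_sup f).
by move=> _ [v [_ v1] <-]; exact: fM.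
Qed.

Lemma opnorm_ge0 (f : clin) : 0 <= opnorm f.
Proof. by apply: le_trans (opnorm_ge f (v := 0) _); rewrite ?normr0. Qed.

Lemma opnormP (f : clin) v : `|f v| <= opnorm f * `|v|.
Proof.
have [->|v0] := eqVneq v 0; first by rewrite linear0 !normr0 mulr0.
have nv : 0 < `|v| by rewrite normr_gt0.
rewrite -ler_pdivrMr// mulrC -[X in X * _](gtr0_norm (x := `|v|^-1)) ?invr_gt0//.
rewrite -normrZ -linearZ; apply: opnorm_ge.
by rewrite normrZ gtr0_norm ?invr_gt0// mulVf ?gt_eqF.
Qed.

Lemma opnormD (f g : clin) : opnorm (f + g) <= opnorm f + opnorm g.
Proof.
apply: opnorm_le => v v1; apply: le_trans (ler_normD _ _) _.
by apply: lerD; exact: opnorm_ge.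
Qed.

Lemma opnormZ (k : R) (f : clin) : opnorm (k *: f) = `|k| * opnorm f.
Proof.
have le_opnormZ (a : R) (g : clin) : opnorm (a *: g) <= `|a| * opnorm g.
  apply: opnorm_le => v v1; rewrite /= [X in `|X|](_ : _ = a *: g v)// normrZ.
  by rewrite ler_wpM2l ?opnorm_ge.
apply/eqP; rewrite eq_le le_opnormZ/=.
have [->|k0] := eqVneq k 0; first by rewrite normr0 mul0r opnorm_ge0.
rewrite -ler_pdivlMl ?normr_gt0// -normfV.
by rewrite -[X in opnorm X <= _](scalerK k0) le_opnormZ.
Qed.

Lemma opnorm0_eq0 (f : clin) : opnorm f = 0 -> f = 0.
Proof.
move=> f0; apply/val_inj/funext => v; apply/eqP.
by have := opnormP f v; rewrite f0 mul0r normr_le0.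
Qed.

HB.instance Definition _ :=
  Lmodule_isNormed.Build R clin opnormD opnormZ opnorm0_eq0.

End ContinuousLinear.
Arguments clin {R} V W.

Section Functionals.
Context {R : realType} {E : normedModType R}.

(* phi is C^2 with first and second Frechet derivatives dphi and d2phi *)
Definition is_C2 (phi : E -> R) (dphi : E -> clin E R)
    (d2phi : E -> clin E (clin E R)) : Prop :=
  [/\ forall u, is_diff u phi (dphi u),
      forall u, is_diff u dphi (d2phi u) & continuous d2phi].

Definition holder_on_bounded {W : normedModType R} (alpha : R) (f : E -> W) :=
  forall r, 0 < r -> exists2 M, 0 < M & forall u1 u2 : E,
    ball 0 r u1 -> ball 0 r u2 -> `|f u1 - f u2| <= M * `|u1 - u2| `^ alpha.

Definition lin_indep k (w : 'I_k -> E) : Prop :=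
  forall a : 'I_k -> R, \sum_i a i *: w i = 0 -> forall i, a i = 0.

Definition dim_le (W : set E) (n : nat) : Prop :=
  forall k (w : 'I_k -> E),
    (forall i, W (w i)) -> lin_indep w -> (k <= n)%N.

Definition infinite_dim : Prop := forall n, ~ dim_le setT n.

(* Suprema are taken in the extended reals, so that the maximum over an empty
   boundary is -oo; on nonempty compact sets they are maxima. *)
Definition max_on (phi : E -> R) (A : set E) : \bar R :=
  ereal_sup [set (phi u)%:E | u in A].

Definition minimax (phi : E -> R) (F : set (set E)) : \bar R :=
  ereal_inf [set max_on phi A | A in F].

Definition homotopic_family (S : set E) (n : nat) (B : set E)
    (F : set (set E)) : Prop :=
  exists (D D0 : set 'rV[R]_n) (eta0 : 'rV[R]_n -> E),
    [/\ compact D, closed D0 /\ D0 `<=` D,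
        {within D0, continuous eta0}, eta0 @` D0 = B &
        F = [set A | A `<=` S /\ exists f : 'rV[R]_n -> E,
          [/\ {within D, continuous f},
              forall x, D0 x -> f x = eta0 x & A = f @` D]]].

End Functionals.
Arguments infinite_dim {R} E.

(* V, with its given norm, is a Hilbert space with inner product ip *)
Definition hilbert_product (R : realType) (V : completeNormedModType R)
    (ip : {dot V for (@idfun R)}) : Prop :=
  forall v, `|v| ^+ 2 = ip v v.

Section Sphere.
Context {R : realType} {E H : completeNormedModType R}.
Variables (ipH : {dot H for (@idfun R)}) (i : {linear E -> H}).

(* E -> H -> E' are continuous injections, the first of norm at most 1; the
   second one is h |-> (h, .), which is automatically continuous. *)
Definition gelfand_triple : Prop :=
  [/\ injective i, forall u, `|i u| <= `|u| &
      injective (fun h : H => (fun u : E => ipH h (i u)))].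

Definition sphere (mu : R) : set E := [set u | ipH (i u) (i u) = mu].

Definition tangent (u : E) : set E := [set v | ipH (i u) (i v) = 0].

(* By the chain rule the differential at u of the restriction of phi to the
   sphere is the restriction of phi'(u) to the tangent space at u. *)
Definition sphere_diff_norm (dphi : E -> clin E R) (u : E) : R :=
  norm_on (tangent u) (dphi u).

Definition D2 (dphi : E -> clin E R) (d2phi : E -> clin E (clin E R))
    (u v w : E) : R :=
  d2phi u v w - dphi u u / ipH (i u) (i u) * ipH (i v) (i w).

End Sphere.

(* Main.v *)
Require Import Defs.
From HB Require Import structures.
From mathcomp Require Import all_boot all_order all_algebra.
From mathcomp Require Import sesquilinear.
From mathcomp Require Import all_classical all_reals all_analysis.
From mathcomp Require Import ring lra zify.

Set Implicit Arguments.
Unset Strict Implicit.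
Unset Printing Implicit Defensive.

Import Order.TTheory GRing.Theory Num.Theory.
Import numFieldNormedType.Exports.

Local Open Scope classical_set_scope.
Local Open Scope ring_scope.

(** If the statement failed for a map [f : D -> S_mu] with image [A], every point of
    [A] above the level [c - eps] would have, with [eta = eps `^ alpha1], either a
    tangent direction of slope below [- 3 * eta] or [n.+1] independent tangent
    directions spanning a space on which the constrained Hessian is below [- eta].
    From this [f] is deformed, without changing it on the boundary part of [D], into
    a map whose values stay below [c], which contradicts the definition of [c].

    Locally, near a point of the first kind [f] is pushed along the steep direction.
    Near a point of the second kind the value decreases quadratically along every
    vector of the frame, but the linear term, which varies with the point, may
    point upwards. The linear terms along the [n.+1] vectors of the frame form a
    continuous map from a compact part of R^n to R^(n+1). Such a map can be
    perturbed so as to avoid the origin ([nonvanishing_approx]), because a Lipschitz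
    image of a bounded part of R^n is negligible in R^(n+1). The direction opposite
    to the perturbed map makes the linear term at most a prescribed tiny number
    ([descent_field]). The moves are tangent steps brought back to the sphere, and
    [sphere_expansion] shows that to second order they see exactly the slope and the
    constrained Hessian. A move of size [rho], with [rho] so small that the
    derivatives oscillate by a small multiple of [eta] over comparable distances,
    gains [eta * rho ^+ 2 / 4] ([sphere_move]).

    Globally, [D] is covered by the supports of bumps of tiny diameter and
    multiplicity at most [4 ^ n] ([finite_cover]), and the moves are performed one
    bump at a time ([sequential_descent]). A point is moved at most [4 ^ n] times, so
    it stays where the local analysis is valid, with constants chosen before the
    diameter of the supports. By Hoelder continuity [rho] may be taken proportional
    to [eta `^ alpha^-1], and the condition on [alpha1] says that the gain
    is then at least of order [eps `^ (1 / 2)]. This exceeds [4 * eps] for small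
    [eps] ([scale_choice]), enough to bring the values from [c + eps] down below [c]
    ([push_below]). *)

(** * Continuous maps on compact sets *)

Section CompactDomain.
Context {R : realType}.

Lemma withinP (V W : normedModType R) (D : set V) (f : V -> W) x :
  f @ within D (nbhs x) --> f x ->
  forall e, 0 < e -> exists2 d, 0 < d &
    forall y, D y -> `|x - y| < d -> `|f x - f y| < e.
Proof.
move=> /cvgrPdist_lt fx e /fx.
move=> /nbhs_ballP[d /= d0 xd]; exists d => // y Dy xy.
by apply: xd => //; rewrite -ball_normE.
Qed.

(** The Heine-Cantor theorem for a function that is continuous only within the
    compact set [D], with values in another normed space. *)
Lemma uniform_continuity (V W : normedModType R) (D : set V) (f : V -> W) :
  compact D -> {within D, continuous f} -> forall e, 0 < e ->
  exists2 d, 0 < d &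
    forall x y, D x -> D y -> `|x - y| < d -> `|f x - f y| < e.
Proof.
move=> /compact_near_coveringP cD /subspace_continuousP fD e e0.
have e20 : 0 < e / 2 by rewrite divr_gt0.

suff [d d0 hd] : exists2 d, 0 < d & forall x, D x ->
    forall y, D y -> `|x - y| < d -> `|f x - f y| < e.
  by exists d => // x y Dx Dy; exact: hd.
  have : \forall d \near (0 : R)^'+, D `<=` (fun x =>
    D x -> forall y, D y -> `|x - y| < d -> `|f x - f y| < e).
    apply: cD => x Dx; have [d d0 hd] := withinP (fD x Dx) e20.
    have d20 : 0 < d / 2 by rewrite divr_gt0.
    exists (ball x (d / 2), [set t | t < d / 2]) => /=.
      split; first exact: nbhsx_ballx.
      exact: nbhs_right_lt.
    move=> [x' t] /= [+ td] Dx' y Dy x'y; rewrite -ball_normE /= => xx'.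
    rewrite [e]splitr; apply: le_lt_trans (ler_distD (f x) _ _) _.
    apply: ltrD; [rewrite distrC|]; apply: hd => //; first by lra.
    by apply: le_lt_trans (ler_distD x' _ _) _; lra.
  move=> nD; near (0 : R)^'+ => d; exists d; first by [].
  have : D `<=` (fun x =>
    D x -> forall y, D y -> `|x - y| < d -> `|f x - f y| < e) by near: d.
  by move=> h x Dx; exact: h.
Unshelve. all: by end_near.
Qed.

Lemma mxnorm_ge m n (x : 'M[R]_(m, n)) i j : `|x i j| <= `|x|.
Proof.
rewrite [leRHS]mx_normrE.
by rewrite (bigmax_sup (i, j)).
Qed.

Lemma mxnorm_le m n (x : 'M[R]_(m, n)) M : 0 <= M ->
  (forall i j, `|x i j| <= M) -> `|x| <= M.
Proof.
by move=> M0 xM; rewrite [leLHS]mx_normrE; apply: bigmax_le => // -[i j] _.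
Qed.

Lemma lipschitz_continuous (V W : normedModType R) (f : V -> W) l :
  (forall x y, `|f x - f y| <= l * `|x - y|) -> continuous f.
Proof.
move=> fl x; apply/cvgrPdist_lt => d d0; near=> y.
apply: le_lt_trans (fl _ _) _.
have l0 : 0 < `|l| + 1 by rewrite ltr_wpDl.
apply: (@le_lt_trans _ _ ((`|l| + 1) * `|x - y|)).
  by rewrite ler_wpM2r// (le_trans (ler_norm _))// lerDl.
rewrite mulrC -ltr_pdivlMr//; near: y.
by apply: cvgr_dist_lt; [exact: cvg_id|rewrite divr_gt0].
Unshelve. all: by end_near.
Qed.

(** The approximation is the inf-convolution of [g] with a steep cone,
        h x = inf over y in D of (g y + l |x - y|).
    An infimum of [l]-Lipschitz functions is [l]-Lipschitz, and for large [l] only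
    the points [y] close to [x], where [g y] is close to [g x], compete for the
    infimum. *)
Lemma lipschitz_approx n (D : set 'rV[R]_n) (g : 'rV[R]_n -> R) e :
  compact D -> {within D, continuous g} -> 0 < e ->
  exists (h : 'rV[R]_n -> R) (l : R), [/\ 0 <= l,
    forall x y, `|h x - h y| <= l * `|x - y| &
    forall x, D x -> `|h x - g x| <= e].
Proof.
move=> cD gD e0.
have [->|/set0P[x0 Dx0]] := eqVneq D set0.
  by exists (fun=> 0), 0; split=> // x y; rewrite subrr normr0 mul0r.
have [b b0 gb] : exists2 b, 0 < b & forall x, D x -> `|g x| <= b.
  have /ex_strict_bound_gt0[b b0 hb] : bounded_set (g @` D).
    exact/compact_bounded/continuous_compact.
  by exists b => // x Dx; apply/ltW/hb; exists x.
have [d d0 hd] := uniform_continuity cD gD e0.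
(* Beyond distance [d] the cone exceeds the oscillation [2 * b] of [g]. *)
pose l := 2 * b / d.
have l0 : 0 <= l by rewrite divr_ge0 ?mulr_ge0 ?ltW.
pose T x := [set g y + l * `|x - y| | y in D].
have T0 x : T x !=set0 by exists (g x0 + l * `|x - x0|), x0.
have Tlb x : has_lbound (T x).
  exists (- b) => _ [y Dy <-]; have := gb _ Dy; rewrite ler_norml => /andP[gy _].
  by rewrite (le_trans gy)// lerDl mulr_ge0.
exists (fun x => inf (T x)), l; split => //.
- have half x y : inf (T x) - inf (T y) <= l * `|x - y|.
    rewrite lerBlDl -lerBlDr; apply: lb_le_inf => // _ [z Dz <-].
    have : inf (T x) <= g z + l * `|x - z| by apply: ge_inf => //; exists z.
    have : l * `|x - z| <= l * `|x - y| + l * `|y - z|.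
      by rewrite -mulrDr ler_wpM2l ?ler_distD.
    lra.
  by move=> x y; rewrite ler_norml half andbT lerNl opprB distrC half.
- move=> x Dx; rewrite ler_norml; apply/andP; split.
    rewrite lerBrDl; apply: lb_le_inf => // _ [z Dz <-].
    have [xz|xz] := ltP (`|x - z|) d.
      have := hd _ _ Dx Dz xz; rewrite ltr_norml => /andP[_].
      have : 0 <= l * `|x - z| by rewrite mulr_ge0.
      lra.
    have : 2 * b <= l * `|x - z|.
      by rewrite /l mulrAC ler_pdivlMr// ler_pM2l// mulr_gt0.
    have := gb _ Dx; have := gb _ Dz; rewrite !ler_norml.
    by move=> /andP[? ?] /andP[? ?]; lra.
  suff : inf (T x) <= g x by lra.
  apply: ge_inf => //; exists x => //.
  by rewrite subrr normr0 mulr0 addr0.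
Qed.


(** * Perturbing a map from R^n to R^(n+1) off the origin *)

Lemma compact_subset_ball n (D : set 'rV[R]_n) : compact D ->
  exists2 b, 0 < b & forall x, D x -> `|x| < b.
Proof. by move=> /compact_bounded/ex_strict_bound_gt0[b b0 hb]; exists b. Qed.

Lemma cube_index (b : R) m : 0 < b -> (0 < m)%N -> forall n (x : 'rV[R]_n), `|x| < b ->
  exists k : {ffun 'I_n -> 'I_m}, forall i,
    (k i)%:R * (2 * b / m%:R) <= x 0 i + b < (k i).+1%:R * (2 * b / m%:R).
Proof.
move=> b0 m0 n x xb.
have m0' : 0 < (m%:R : R) by rewrite ltr0n.
pose s := 2 * b / m%:R.
have s0 : 0 < s by rewrite divr_gt0// mulr_gt0.
have xi i : 0 <= x 0 i + b < 2 * b.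
  by have := le_lt_trans (mxnorm_ge x ord0 i) xb; rewrite ltr_norml; lra.
have hk i : (Num.truncn ((x 0 i + b) / s)%R < m)%N.
  have /andP[x0 x1] := xi i.
  have /truncn_itv/andP[tr _] : 0 <= (x 0 i + b) / s by rewrite divr_ge0// ltW.
  rewrite -(ltr_nat R); apply: le_lt_trans tr _.
  by rewrite ltr_pdivrMr// /s mulrC divfK ?gt_eqF.
exists [ffun i => Ordinal (hk i)] => i; rewrite ffunE /= -/s.
have /andP[x0 x1] := xi i.
rewrite -ler_pdivlMr// -ltr_pdivrMr//; apply: truncn_itv.
by rewrite divr_ge0// ltW.
Qed.

(** A Lipschitz image of a bounded part of R^n is null in R^(n+1); here is the
    finite version of this fact that yields a small value that is not taken.
    Subdividing the domain into [m ^ n] cells makes the image of each cell smaller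
    than the spacing of a grid of [q ^ n.+1] points with [q] proportional to [m],
    so a cell reaches at most one grid point, and for large [q] there are more grid
    points than cells. *)
Lemma lipschitz_image_avoids n (D : set 'rV[R]_n) (h : 'rV[R]_n -> 'rV[R]_n.+1)
    (b l e : R) : (forall x, D x -> `|x| < b) -> 0 <= l -> 0 < e ->
  (forall x y, `|h x - h y| <= l * `|x - y|) ->
  exists2 p, `|p| <= e & forall x, D x -> h x != p.
Proof.
move=> Db l0 e0 hl.
have [D0|/set0P[x0 Dx0]] := eqVneq D set0.
  by exists 0 => [|x]; rewrite ?normr0 ?ltW ?D0.
have b0 : 0 < b by rewrite (le_lt_trans _ (Db _ Dx0)).
have c0 : 0 < 2 * b * l + 1 by rewrite ltr_wpDl// !mulr_ge0// ltW.
pose La := (Num.truncn ((2 * b * l + 1) / e)).+1.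
have La0 : 0 < (La%:R : R) by rewrite ltr0n.
have hLa : 2 * b * l + 1 < e * La%:R.
  have /truncn_itv/andP[_] : 0 <= (2 * b * l + 1) / e by rewrite divr_ge0// ltW.
  by rewrite ltr_pdivrMr// [_ * e]mulrC.
(* [La] bounds the ratio of the image of a cell to the grid spacing, so [q > La ^ n]
   gives [q ^ n.+1 > (La * q) ^ n = m ^ n]. *)
pose q := (La ^ n).+1; pose m := (La * q)%N.
have q0 : 0 < (q%:R : R) by rewrite ltr0n.
have m0 : (0 < m)%N by rewrite muln_gt0.
have m0' : 0 < (m%:R : R) by rewrite ltr0n.
(* The grid lies in the cube [0, e]^(n+1) and has spacing [tau]. *)
pose tau := e / q%:R.
have tau0 : 0 < tau by rewrite divr_gt0.
pose P (k : {ffun 'I_n.+1 -> 'I_q}) : 'rV[R]_n.+1 := \row_i ((k i)%:R * tau).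
have Pe k : `|P k| <= e.
  apply: mxnorm_le => [|i j]; first exact: ltW.
  rewrite mxE ger0_norm; last by rewrite mulr_ge0// ltW.
  rewrite /tau mulrA ler_pdivrMr// mulrC.
  by rewrite ler_pM2l// ler_nat ltnW.
apply: contrapT => nex.
have ex k : exists x, D x /\ h x = P k.
  apply: contrapT => nx; apply: nex; exists (P k) => // x Dx.
  by apply/eqP => hx; apply: nx; exists x.
have [X hX] := choice ex.
have [kap hkap] := choice (fun k => cube_index b0 m0 (Db _ (hX k).1)).
have kap_inj : injective kap.
  move=> k k' kk'; apply/ffunP => i; apply/val_inj => /=.
  have sm : l * (2 * b / m%:R) < tau.
    have -> : l * (2 * b / m%:R) = 2 * b * l / La%:R / q%:R.
      by rewrite /m natrM; field; rewrite !gt_eqF.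
    by rewrite ltr_pM2r ?invr_gt0// ltr_pdivrMr//; lra.
  have dX : `|X k - X k'| <= 2 * b / m%:R.
    apply: mxnorm_le => [|j i']; first by rewrite divr_ge0// ?mulr_ge0// ltW.
    have := hkap k i'; have := hkap k' i'; rewrite kk' !mxE !ord1.
    set s := 2 * b / _; set t := kap k' i'.
    rewrite -!(natr1 t) !(mulrDl _ _ s) mul1r ler_norml.
    by move=> /andP[? ?] /andP[? ?]; apply/andP; split; lra.
  have dP : `|P k - P k'| < tau.
    rewrite -(hX k).2 -(hX k').2; apply: le_lt_trans (hl _ _) _.
    by apply: le_lt_trans sm; rewrite ler_wpM2l.
  have := le_lt_trans (mxnorm_ge (P k - P k') ord0 i) dP.
  rewrite !mxE -mulrBl normrM (gtr0_norm tau0) gtr_pMl//.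
  rewrite ltr_norml => /andP[h1 h2].
  have {}h2 : (k i < (k' i).+1)%N by rewrite -(ltr_nat R) -natr1; lra.
  have {}h1 : (k' i < (k i).+1)%N by rewrite -(ltr_nat R) -natr1; lra.
  by apply/eqP; rewrite eqn_leq -ltnS h2.
have := leq_card _ kap_inj; rewrite !card_ffun !card_ord leqNgt => /negP; apply.
by rewrite /m expnMn expnS ltn_pmul2r ?expn_gt0.
Qed.

(** Were [g] nowhere zero, [a := - g] would point against [g]. In general [g] is
    first replaced by a Lipschitz map [H] close to it and then shifted by a small
    value [p] that [H] does not take: [a := p - H] vanishes nowhere and still
    approximates [- g], so its scalar product with [g] is almost nonpositive. This
    is where it matters that there are more functions than coordinates. *)
Lemma nonvanishing_approx n (D : set 'rV[R]_n) (g : 'rV[R]_n -> 'I_n.+1 -> R) e :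
  compact D -> (forall i, {within D, continuous (g^~ i)}) -> 0 < e ->
  exists a : 'rV[R]_n -> 'rV[R]_n.+1, [/\ continuous a,
    forall x, D x -> a x != 0 &
    forall x, D x -> \sum_i a x 0 i * g x i <= e * `|a x|].
Proof.
move=> cD cg e0.
have e2 : 0 < e / (2 * n.+1%:R) by rewrite divr_gt0.
have [h hh] := choice (fun i => lipschitz_approx cD (cg i) e2).
have [l hl] := choice hh.
pose H x : 'rV[R]_n.+1 := \row_i h i x.
pose L := \sum_i l i.
have lL i : l i <= L.
  by rewrite /L (bigD1 i)//= lerDl sumr_ge0// => j _; have [] := hl j.
have L0 : 0 <= L by rewrite sumr_ge0// => j _; have [] := hl j.
have HL x y : `|H x - H y| <= L * `|x - y|.
  apply: mxnorm_le => [|i j]; first by rewrite mulr_ge0.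
  rewrite !mxE; have [_ + _] := hl j; move/(_ x y) => /le_trans; apply.
  by rewrite ler_wpM2r.
have [b b0 Db] := compact_subset_ball cD.
have [p pe hp] := lipschitz_image_avoids Db L0 e2 HL.
exists (fun x => p - H x); split.
- apply: (@lipschitz_continuous _ _ _ L) => x y.
  by rewrite opprB addrC addrA subrK distrC.
- by move=> x Dx; rewrite subr_eq0 eq_sym hp.
- move=> x Dx; apply: (@le_trans _ _ (\sum_(i < n.+1) (e / n.+1%:R * `|p - H x|))).
    apply: ler_sum => i _.
    set a := (p - H x) 0 i.
    have ga : `|a + g x i| <= e / n.+1%:R.
      have -> : a + g x i = p 0 i - (h i x - g x i).
        by rewrite /a !mxE opprB addrA addrAC.
      apply: le_trans (ler_normB _ _) _.
      have [_ _ /(_ x Dx) h2] := hl i.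
      have := le_trans (mxnorm_ge p ord0 i) pe.
      have -> : e / n.+1%:R = 2 * (e / (2 * n.+1%:R)) by rewrite invfM mulrCA mulVKf.
      by move: h2; set t := e / (2 * _); lra.
    (* [a + g] is small, and the square has the favourable sign. *)
    have -> : a * g x i = a * (a + g x i) - a ^+ 2 by rewrite mulrDr expr2; lra.
    apply: (@le_trans _ _ (a * (a + g x i))); first by rewrite lerBlDr lerDl sqr_ge0.
    apply: le_trans (ler_norm _) _; rewrite normrM mulrC.
    by apply: ler_pM => //; exact: mxnorm_ge.
  by rewrite sumr_const card_ord -mulrnAl -[e / _ *+ _]mulr_natr divfK.
Qed.

(** * Covers of bounded multiplicity *)

Lemma clamp_dist (s t : R) :
  `|Num.max 0 (Num.min 1 s) - Num.max 0 (Num.min 1 t)| <= `|s - t|.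
Proof.
rewrite /Num.max /Num.min ler_norml.
have := ler_norm (s - t); have := ler_norm (t - s); rewrite [`|t - s|]distrC.
move: `|s - t| => e h1 h2.
by case: (ltP 1 s) => ?; case: (ltP 1 t) => ?;
  repeat match goal with |- context [if ?a < ?b then _ else _] =>
  case: (ltP a b) => ? end; apply/andP; split; lra.
Qed.

(** Bumps centred at the points of a fine cubic lattice. That the multiplicity
    does not depend on the mesh [h] is what allows the deformations made on the
    supports to be composed with a total displacement and a total loss that are
    bounded before the mesh is chosen. *)
Lemma finite_cover n (D : set 'rV[R]_n) h : compact D -> 0 < h ->
  exists (I : finType) (psi : I -> 'rV[R]_n -> R), [/\
    forall k, continuous (psi k),
    forall k x, 0 <= psi k x <= 1,
    forall k x y, psi k x != 0 -> psi k y != 0 -> `|x - y| < h,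
    forall x, D x -> exists k, psi k x = 1 &
    forall x, (#|[pred k | psi k x != 0%R]| <= 4 ^ n)%N].
Proof.
move=> cD h0; have [b b0 Db] := compact_subset_ball cD.
(* A bump equals 1 up to distance [s] from its centre and vanishes from [2 * s] on,
   hence the mesh [s] is taken below [h / 4]. *)
pose m := (Num.truncn (8 * b / h)).+1.
have m0 : 0 < (m%:R : R) by rewrite ltr0n.
pose s := 2 * b / m%:R.
have s0 : 0 < s by rewrite divr_gt0// mulr_gt0.
have sh : 4 * s < h.
  have /truncn_itv/andP[_] : 0 <= 8 * b / h.
    by rewrite divr_ge0 ?mulr_ge0 ?ltW.
  rewrite ltr_pdivrMr// -/m [_ * h]mulrC -ltr_pdivrMr// => bm.
  by rewrite /s mulrA; apply: le_lt_trans bm; rewrite ler_pM2r ?invr_gt0//; lra.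
pose v (k : {ffun 'I_n -> 'I_m}) : 'rV[R]_n := \row_i ((k i)%:R * s - b).
pose d k x := 2 - `|x - v k| / s.
have dL k x y : `|d k x - d k y| <= s^-1 * `|x - y|.
  have -> : d k x - d k y = s^-1 * (`|y - v k| - `|x - v k|) by rewrite /d; ring.
  rewrite normrM gtr0_norm ?invr_gt0// ler_pM2l ?invr_gt0//.
  apply: le_trans (ler_dist_dist _ _) _.
  by rewrite opprB addrA subrK distrC.
pose psi k x := Num.max 0 (Num.min 1 (d k x)).
have psi_neq0 k x : psi k x != 0 -> `|x - v k| < 2 * s.
  apply: contraR; rewrite -leNgt -ler_pdivlMr// => sx.
  rewrite /psi /d; apply/eqP; apply: max_l; rewrite ge_min.
  by apply/orP; right; lra.
have near2 k x y : `|x - v k| < 2 * s -> `|y - v k| < 2 * s -> `|x - y| < 4 * s.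
  rewrite [`|y - _|]distrC => xk ky.
  by apply: le_lt_trans (ler_distD (v k) _ _) _; lra.
exists {ffun 'I_n -> 'I_m}, psi; split.
- move=> k; apply: (@lipschitz_continuous _ _ _ s^-1) => x y.
  exact: le_trans (clamp_dist _ _) (dL _ _ _).
- by move=> k x; rewrite /psi le_max lexx ge_max ler01 ge_min lexx.
- move=> k x y /psi_neq0 xk /psi_neq0 yk.
  exact: lt_trans (near2 _ _ _ xk yk) sh.
- move=> x Dx; have [k hk] := cube_index b0 (ltn0Sn _ : 0 < m)%N (Db x Dx).
  exists k; rewrite /psi.
  suff xk : `|x - v k| <= s.
    have ? : `|x - v k| / s <= 1 by rewrite ler_pdivrMr// mul1r.
    by rewrite min_l ?max_r// /d; lra.
  apply: mxnorm_le => [|i j]; first exact: ltW.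
  rewrite !mxE !ord1; have := hk j; rewrite -/s -!(natr1 (k j)) mulrDl mul1r.
  by rewrite ler_norml; lra.
- move=> x.
  (* Two centres whose bumps meet at [x] differ by less than 4 lattice steps in each
     coordinate, hence are determined by their residues modulo 4. *)
  pose c (k : {ffun 'I_n -> 'I_m}) : {ffun 'I_n -> 'I_4} :=
    [ffun i => Ordinal (ltn_pmod (k i) (isT : 0 < 4)%N)].
  have c_inj : {in [pred k | psi k x != 0] &, injective c}.
    move=> k k'; rewrite !inE => /psi_neq0 xk /psi_neq0 xk' /ffunP cc.
    apply/ffunP => i; apply/val_inj.
    have := cc i; rewrite !ffunE => -[] /= cci.
    have vv : `|v k - v k'| < 4 * s.
      apply: le_lt_trans (ler_distD x _ _) _; rewrite [`|v k - x|]distrC; lra.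
    have := le_lt_trans (mxnorm_ge (v k - v k') ord0 i) vv; rewrite !mxE.
    have -> : (k i)%:R * s - b - ((k' i)%:R * s - b) = s * ((k i)%:R - (k' i)%:R) by ring.
    rewrite normrM gtr0_norm// [4 * s]mulrC ltr_pM2l// ltr_norml => /andP[h1 h2].
    have {}h2 : (k i < k' i + 4)%N by rewrite -(ltr_nat R) natrD; lra.
    have {}h1 : (k' i < k i + 4)%N by rewrite -(ltr_nat R) natrD; lra.
    by move: (k i : nat) (k' i : nat) cci h1 h2 => p q; lia.
  rewrite -(card_in_image c_inj); apply: leq_trans (max_card _) _.
  by rewrite card_ffun !card_ord.
Qed.

End CompactDomain.

(** * Second order Taylor estimate *)

Section Bilinear.
Context {R : realType}.

Lemma bounded_biadditive_cvg (U V W : normedModType R) (beta : U -> V -> W) (C : R)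
    (T : Type) (F : set_system T) {FF : Filter F} (f : T -> U) (g : T -> V) (a : U) (c : V) :
  (forall u v w, beta (u - v) w = beta u w - beta v w) ->
  (forall u v w, beta u (v - w) = beta u v - beta u w) ->
  (forall u v, `|beta u v| <= C * `|u| * `|v|) ->
  f @ F --> a -> g @ F --> c -> (fun x => beta (f x) (g x)) @ F --> beta a c.
Proof.
move=> betaBl betaBr betaC fa gc.
pose e x := C * `|a - f x| * `|c| + C * `|f x| * `|c - g x|.
have e0 : e @ F --> (0 : R).
  rewrite [X in _ --> X](_ : 0 = C * `|a - a| * `|c| + C * `|a| * `|c - c|); last first.
    by rewrite !subrr !normr0; ring.
  apply: cvgD; apply: cvgM.
  - apply: cvgM; [exact: cvg_cst|apply: cvg_norm; apply: cvgB => //; exact: cvg_cst].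
  - exact: cvg_cst.
  - by apply: cvgM; [exact: cvg_cst|exact: cvg_norm].
  - apply: cvg_norm; apply: cvgB => //; exact: cvg_cst.
apply/cvgrPdist_lt => d d0; near=> x.
have : `|0 - e x| < d by near: x; exact: cvgr_dist_lt.
rewrite sub0r normrN; apply: le_lt_trans; apply: le_trans (ler_norm _).
have -> : beta a c - beta (f x) (g x) = beta (a - f x) c + beta (f x) (c - g x).
  by rewrite betaBl betaBr addrA subrK.
by apply: le_trans (ler_normD _ _) _; apply: lerD; exact: betaC.
Unshelve. all: by end_near.
Qed.

Lemma clin_eval_cvg (V W : normedModType R) (T : Type) (F : set_system T)
    {FF : Filter F} (A : T -> clin V W) (g : T -> V) (A0 : clin V W) (v0 : V) :
  A @ F --> A0 -> g @ F --> v0 -> (fun x => A x (g x)) @ F --> A0 v0.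
Proof.
apply: (@bounded_biadditive_cvg _ _ _ (fun (A : clin V W) v => A v) 1) => //.
- by move=> u v w; rewrite linearB.
- by move=> u v; rewrite mul1r opnormP.
Qed.

Variables (E : normedModType R) (phi : E -> R) (dphi : E -> clin E R)
  (d2phi : E -> clin E (clin E R)).
Hypothesis phiC2 : is_C2 phi dphi d2phi.

Lemma is_derive_line (W : normedModType R) (f : E -> W) (df : E -> W) (u z : E) (t : R) :
  is_diff (u + t *: z) f df -> is_derive t 1 (fun s : R => f (u + s *: z)) (df z).
Proof.
move=> fdf.
have lin : is_diff t (fun s : R => u + s *: z) (fun s : R => s *: z).
  have -> : (fun s : R => u + s *: z) = cst u + *:%R ^~ z by [].
  by apply: is_diff_eq; rewrite add0r.
have /= h := is_diff_comp lin fdf.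
have [h1 h2] := h.
apply: DeriveDef; first exact/derivable1_diffP.
by rewrite deriveE// h2 /= scale1r.
Qed.

Lemma is_derive_phi_line u z (t : R) :
  is_derive t 1 (fun s : R => phi (u + s *: z)) (dphi (u + t *: z) z).
Proof. by case: phiC2 => h _ _; exact: (is_derive_line (h _)). Qed.

Lemma is_derive_dphi_line u z (t : R) :
  is_derive t 1 (fun s : R => dphi (u + s *: z) z) (d2phi (u + t *: z) z z).
Proof.
case: phiC2 => _ h _.
have [h1 h2] := is_derive_line (h (u + t *: z)).
move: h1; rewrite /derivable => /cvg_ex[l hl].
have {h2}ld : l = d2phi (u + t *: z) z.
  by rewrite -h2 /derive; apply/esym; exact: (cvg_lim (@norm_hausdorff _ _) hl).
have {}hl : (fun h : R => h^-1 *: ((fun s => dphi (u + s *: z) z) (h *: (1 : R) + t)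
    - dphi (u + t *: z) z)) @ (0 : R)^' --> l z.
  exact: (clin_eval_cvg hl (cvg_cst z)).
rewrite ld in hl; apply: DeriveDef; first by apply/cvg_ex; eexists; exact: hl.
by rewrite /derive; apply: cvg_lim => //; exact: norm_hausdorff.
Qed.

Lemma is_C2_continuous : continuous phi.
Proof. by case: phiC2 => h _ _ u; have [h1 _] := h u; exact: differentiable_continuous. Qed.

Lemma is_C2_dcontinuous : continuous dphi.
Proof. by case: phiC2 => _ h _ u; have [h1 _] := h u; exact: differentiable_continuous. Qed.

Lemma mean_value_le (f df : R -> R) (M t : R) : 0 <= t ->
  (forall s : R, is_derive s (1 : R) f (df s)) -> (forall s, 0 <= s <= t -> df s <= M) ->
  f t <= f 0 + M * t.
Proof.
move=> t0 fdf dfM.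
have fc : {within `[0, t], continuous f}.
  apply: continuous_subspaceT => s; have [h _] := fdf s.
  exact/differentiable_continuous/derivable1_diffP.
have [c] := MVT_segment t0 (fun s _ => fdf s) fc.
rewrite in_itv/= subr0 -lerBlDl => ct ->.
by rewrite ler_wpM2r// dfM.
Qed.

(** The first derivative along the segment is compared with its linear
    approximation by the mean value inequality, and a second application integrates
    that estimate. Only the oscillation [om] of the second derivative on the segment
    enters, so its Hoelder continuity controls the remainder. *)
Lemma taylor2_le u z om :
  (forall t : R, 0 <= t <= 1 -> `|d2phi (u + t *: z) - d2phi u| <= om) ->
  phi (u + z) <= phi u + dphi u z + d2phi u z z / 2 + om * `|z| ^+ 2.
Proof.
move=> hom; set Q := d2phi u z z; set A := dphi u z.
have d1 (t : R) : 0 <= t <= 1 -> dphi (u + t *: z) z <= A + t * Q + om * `|z| ^+ 2.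
  move=> /andP[t0 t1].
  have /(_ (om * `|z| ^+ 2)) := @mean_value_le (fun s => dphi (u + s *: z) z - s * Q)
    (fun s => d2phi (u + s *: z) z z - Q) _ t t0.
  have -> : dphi (u + 0 *: z) z - 0 * Q = A by rewrite scale0r addr0 mul0r subr0.
  rewrite lerBlDr => h; apply: le_trans (h _ _) _.
  - move=> s; apply: is_deriveB; first exact: is_derive_dphi_line.
    change (is_derive s 1 ((fun s : R => s) * (fun=> Q)) Q).
    by apply: is_derive_eq; rewrite /GRing.scale /=; ring.
  - move=> s /andP[s0 st].
    have -> : d2phi (u + s *: z) z z - Q = (d2phi (u + s *: z) - d2phi u) z z by [].
    apply: le_trans (ler_norm _) _.
    apply: le_trans (opnormP ((d2phi (u + s *: z) - d2phi u) z) z) _.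
    rewrite expr2 mulrA ler_wpM2r//.
    apply: le_trans (opnormP (d2phi (u + s *: z) - d2phi u) z) _.
    by rewrite ler_wpM2r// hom// s0 (le_trans st).
  - rewrite addrAC lerD2l ler_piMr// mulr_ge0 ?exprn_ge0//.
    by apply: le_trans (hom 0 _); rewrite ?lexx ?ler01.
have /(_ (om * `|z| ^+ 2)) := @mean_value_le
  (fun s => phi (u + s *: z) - (s * A + s ^+ 2 * (Q / 2)))
    (fun s => dphi (u + s *: z) z - (A + s * Q)) _ 1 ler01.
rewrite scale0r addr0 !mul0r expr0n /= mul0r addr0 subr0 scale1r expr1n !mul1r mulr1.
rewrite lerBlDr => h; apply: le_trans (h _ _) _.
- move=> s; apply: is_deriveB; first exact: is_derive_phi_line.
  change (is_derive s 1 ((fun s : R => s) * (fun=> A) +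
    (fun s : R => s) ^+ 2 * (fun=> Q / 2)) (A + s * Q)).
  by apply: is_derive_eq; rewrite /GRing.scale /=; field.
- by move=> s /d1; lra.
- lra.
Qed.
End Bilinear.

(** * Second order expansion on the sphere *)

Section Sphere.
Context {R : realType} {E : normedModType R}.
Variables (b : E -> E -> R) (mu : R).
Hypothesis b_lin : forall k u v w, b (k *: u + v) w = k * b u w + b v w.
Hypothesis b_sym : forall u v, b u v = b v u.
Hypothesis b_ge0 : forall u, 0 <= b u u.
Hypothesis b_le : forall u v, `|b u v| <= `|u| * `|v|.
Hypothesis mu_gt0 : 0 < mu.

Lemma form_linr u k v w : b u (k *: v + w) = k * b u v + b u w.
Proof. by rewrite b_sym b_lin !(b_sym _ u). Qed.

Lemma formBl u v w : b (u - v) w = b u w - b v w.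
Proof. by rewrite addrC -scaleN1r b_lin mulN1r addrC. Qed.

Lemma formBr u v w : b u (v - w) = b u v - b u w.
Proof. by rewrite b_sym formBl !(b_sym _ u). Qed.

Lemma form_cvg (T : Type) (F : set_system T) {FF : Filter F} (f g : T -> E) (x y : E) :
  f @ F --> x -> g @ F --> y -> (fun t => b (f t) (g t)) @ F --> b x y.
Proof.
apply: (@bounded_biadditive_cvg _ _ _ R^o b 1).
- exact: formBl.
- exact: formBr.
- by move=> u v; rewrite mul1r.
Qed.

(** Projection of [w] onto the tangent space at [u], orthogonally for [b]. *)
Definition tproj u w := w - (b u w / mu) *: u.

(** For [w] tangent at [u] this is the point of the sphere above [w] in the graph
    parametrisation over the tangent space. Unlike [u + w] rescaled to the sphere,
    it leaves the tangential component of the displacement equal to [w]. *)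
Definition retr u w := Num.sqrt (1 - b w w / mu) *: u + w.

Lemma retr0 u : retr u 0 = u.
Proof.
have b00 : b 0 0 = 0 by have := formBl 0 0 0; rewrite !subrr.
by rewrite /retr b00 mul0r subr0 sqrtr1 scale1r addr0.
Qed.

Lemma form_tproj u w : b u u = mu -> b u (tproj u w) = 0.
Proof.
move=> uS; rewrite /tproj formBr -[_ *: u]addr0 form_linr uS.
have -> : b u 0 = 0 by have := formBr u 0 0; rewrite !subrr.
by rewrite addr0 divfK ?subrr// gt_eqF.
Qed.

Lemma retr_sphere u w : b u u = mu -> b u w = 0 -> b w w <= mu ->
  b (retr u w) (retr u w) = mu.
Proof.
move=> uS uw wmu; rewrite /retr b_lin !form_linr (b_sym w u) uS uw.
rewrite !mulr0 add0r addr0 mulrA -expr2 sqr_sqrtr; last first.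
  by rewrite subr_ge0 ler_pdivrMr// mul1r.
by rewrite mulrBl mul1r divfK ?subrK// gt_eqF.
Qed.

(** Bounds the drop of [retr] towards the origin to second order; the term
    [s / 2], quadratic in the step, produces the curvature correction in the Hessian along the sphere. *)
Lemma sqrt_expansion (s : R) : 0 <= s <= 1 ->
  s / 2 <= 1 - Num.sqrt (1 - s) <= s / 2 + s ^+ 2 / 2.
Proof.
move=> /andP[s0 s1]; apply/andP; split.
  suff : Num.sqrt (1 - s) <= 1 - s / 2 by lra.
  rewrite -[leRHS]ger0_norm; last by lra.
  rewrite -sqrtr_sqr ler_sqrt ?sqr_ge0//.
  nra.
suff : (1 - s) * (1 + s / 2) <= Num.sqrt (1 - s) by lra.
rewrite -[leLHS]ger0_norm; last by apply: mulr_ge0; lra.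
rewrite -sqrtr_sqr ler_sqrt; last by lra.
have -> : ((1 - s) * (1 + s / 2)) ^+ 2 = (1 - s) * (1 - s ^+ 2 * (3 + s) / 4) by field.
apply: ler_piMr; first by lra.
have : 0 <= s ^+ 2 * (3 + s) by rewrite mulr_ge0 ?sqr_ge0//; lra.
lra.
Qed.

(** The point [retr u w] differs from [u + w] by a multiple of [u] of order
    [|w| ^ 2] only; the hypotheses make this smaller than [|w|]. *)
Lemma retr_dist L u w : 1 <= L -> mu^-1 <= L -> `|u| <= L -> L ^+ 2 * `|w| <= 1 ->
  [/\ `|w| <= 1, b w w / mu <= L * `|w| ^+ 2, 0 <= b w w / mu <= 1 &
  `|retr u w - u| <= 2 * `|w|].
Proof.
move=> L1 muL uL wL.
have L0 : 0 < L := lt_le_trans ltr01 L1.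
have w1 : `|w| <= 1 by apply: le_trans wL; rewrite ler_peMl// exprn_ege1.
have s0 : 0 <= b w w / mu by rewrite divr_ge0// ltW.
have sL : b w w / mu <= L * `|w| ^+ 2.
  rewrite mulrC; apply: ler_pM => //; first by rewrite invr_ge0 ltW.
  by apply: le_trans (ler_norm _) _; rewrite expr2.
have Lw1 : L * `|w| <= 1.
  by apply: le_trans wL; rewrite expr2 -mulrA ler_peMl// mulr_ge0// ltW.
have s1 : b w w / mu <= 1.
  apply: le_trans sL _; rewrite expr2 mulrA -[leRHS]mulr1.
  by apply: ler_pM => //; rewrite mulr_ge0// ltW.
split => //; first by rewrite s0.
have /andP[k0 k1] : b w w / mu / 2 <= 1 - Num.sqrt (1 - b w w / mu) <=
  b w w / mu / 2 + (b w w / mu) ^+ 2 / 2 by apply: sqrt_expansion; rewrite s0.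
have -> : retr u w - u = w - (1 - Num.sqrt (1 - b w w / mu)) *: u.
  by rewrite /retr scalerBl scale1r opprB addrAC addrC addrA.
set k := 1 - _ in k0 k1 *.
have kL : k <= L * `|w| ^+ 2.
  apply: le_trans sL; apply: le_trans k1 _.
  have : (b w w / mu) ^+ 2 <= b w w / mu by rewrite expr2 ler_piMr.
  lra.
have kge0 : 0 <= k by lra.
apply: le_trans (ler_normB _ _) _; rewrite normrZ ger0_norm//.
have : k * `|u| <= `|w|.
  apply: (@le_trans _ _ (L * `|w| ^+ 2 * L)); first exact: ler_pM.
  have -> : L * `|w| ^+ 2 * L = (L ^+ 2 * `|w|) * `|w| by ring.
  exact: ler_piMl.
lra.
Qed.

Variables (phi : E -> R) (dphi : E -> clin E R) (d2phi : E -> clin E (clin E R)).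
Hypothesis phiC2 : is_C2 phi dphi d2phi.

(** The bilinear form D^2 phi(u) of the constrained problem: the Hessian along the
    sphere, the quotient being the Lagrange multiplier at [u]. *)
Definition sphere_hessian u v w := d2phi u v w - dphi u u / b u u * b v w.

Lemma clin_le (V W : normedModType R) (f : clin V W) v (x y : R) :
  `|f| <= x -> `|v| <= y -> `|f v| <= x * y.
Proof.
move=> fx vy; apply: le_trans (opnormP f v) _;
  apply: ler_pM => //; exact: opnorm_ge0.
Qed.

Lemma clin2_le (f : clin E (clin E R)) v w (x y z : R) :
  `|f| <= x -> `|v| <= y -> `|w| <= z -> `|f v w| <= x * y * z.
Proof. by move=> fx vy wz; apply: clin_le => //; exact: clin_le. Qed.

Lemma clin_subE (f g : clin E R) v : (f - g) v = f v - g v.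
Proof. by []. Qed.

Lemma clin2_subE (f g : clin E (clin E R)) v w : (f - g) v w = f v w - g v w.
Proof. by []. Qed.

Lemma clinZ (f : clin E R) k v : f (k *: v) = k * f v.
Proof. by rewrite linearZ. Qed.

Lemma clin2Z (f : clin E (clin E R)) k v w : f (k *: v) w = k * f v w.
Proof. by rewrite linearZ. Qed.

Lemma clinBZ (f : clin E R) u k v : f (u - k *: v) = f u - k * f v.
Proof. by rewrite linearB linearZ. Qed.

Lemma clin2BZ (f : clin E (clin E R)) u k v w :
  f (u - k *: v) w = f u w - k * f v w.
Proof. by rewrite linearB linearZ. Qed.

(** Collects the error terms of [sphere_expansion]. Here [X] stands for the norm
    of the tangent step, [s] for [b w w / mu], [k] for the coefficient of [- u] in
    the displacement, [zz] for the Taylor remainder, and the last four reals for values of the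
    derivatives. *)
Lemma expansion_arith (L om X s k zz Au Bwu Buw Buu : R) :
  1 <= L -> 0 <= om -> 0 <= X -> X <= 1 -> X <= om -> 0 <= s -> s <= 1 ->
  s <= L * X ^+ 2 -> s / 2 <= k -> k <= s / 2 + s ^+ 2 / 2 ->
  zz <= om * (2 * X) ^+ 2 -> `|Au| <= L * L -> `|Bwu| <= L * X * L ->
  `|Buw| <= L * L * X -> `|Buu| <= L * L * L ->
  zz + (s / 2 - k) * Au - (k * Bwu + k * Buw) / 2 + k ^+ 2 * Buu / 2 <=
  6 * L ^+ 5 * om * X ^+ 2.
Proof.
move=> L1 om0 X0 X1 Xom s0 s1 sL k0 k1 zzX hAu hBwu hBuw hBuu.
have L0 : 0 <= L := le_trans ler01 L1.
have L5 i : (i <= 5)%N -> L ^+ i <= L ^+ 5 by move=> i5; rewrite ler_weXn2l.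
have kL : k <= L * X ^+ 2.
  have : s ^+ 2 <= s by rewrite expr2 ler_piMr.
  lra.
have kge0 : 0 <= k by lra.
have kk : `|k| = k by rewrite ger0_norm.
set Y := om * X ^+ 2.
have Y0 : 0 <= Y by rewrite mulr_ge0// exprn_ge0.
have X3 : X ^+ 3 <= Y by rewrite exprS ler_wpM2r// exprn_ge0.
have X4 : X ^+ 4 <= Y.
  by apply: le_trans X3; rewrite exprS ler_piMl// exprn_ge0.
have mono i j : (i <= 5)%N -> X ^+ j <= Y -> L ^+ i * X ^+ j <= L ^+ 5 * Y.
  by move=> i5 Xj; apply: ler_pM => //; rewrite ?exprn_ge0// L5.
have f1 : zz <= 4 * (L ^+ 5 * Y).
  apply: le_trans zzX _.
  have -> : om * (2 * X) ^+ 2 = 4 * (1 * Y) by rewrite /Y; ring.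
  by rewrite ler_wpM2l// ler_wpM2r// exprn_ege1.
have f2 : `|(s / 2 - k) * Au| <= L ^+ 5 * Y / 2.
  rewrite normrM.
  apply: (@le_trans _ _ ((L * X ^+ 2) ^+ 2 / 2 * (L * L))).
    apply: ler_pM => //; rewrite distrC ger0_norm; last by lra.
    have : s ^+ 2 <= (L * X ^+ 2) ^+ 2.
      by rewrite lerXn2r// nnegrE mulr_ge0// exprn_ge0.
    lra.
  have -> : (L * X ^+ 2) ^+ 2 / 2 * (L * L) = L ^+ 4 * X ^+ 4 / 2 by field.
  by rewrite ler_pM2r ?invr_gt0// mono.
have f3 : `|k * Bwu| <= L ^+ 5 * Y.
  rewrite normrM kk; apply: (@le_trans _ _ (L * X ^+ 2 * (L * X * L))).
    exact: ler_pM.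
  have -> : L * X ^+ 2 * (L * X * L) = L ^+ 3 * X ^+ 3 by ring.
  exact: mono.
have f4 : `|k * Buw| <= L ^+ 5 * Y.
  rewrite normrM kk; apply: (@le_trans _ _ (L * X ^+ 2 * (L * L * X))).
    exact: ler_pM.
  have -> : L * X ^+ 2 * (L * L * X) = L ^+ 3 * X ^+ 3 by ring.
  exact: mono.
have f5 : `|k ^+ 2 * Buu| <= L ^+ 5 * Y.
  rewrite normrM ger0_norm ?exprn_ge0//.
  apply: (@le_trans _ _ ((L * X ^+ 2) ^+ 2 * (L * L * L))).
    by apply: ler_pM => //; rewrite ?exprn_ge0// lerXn2r// nnegrE mulr_ge0// exprn_ge0.
  have -> : (L * X ^+ 2) ^+ 2 * (L * L * L) = L ^+ 5 * X ^+ 4 by ring.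
  exact: mono.
have -> : 6 * L ^+ 5 * om * X ^+ 2 = 6 * (L ^+ 5 * Y) by rewrite /Y; ring.
move: f2 f3 f4 f5; rewrite !ler_norml.
by move=> /andP[? ?] /andP[? ?] /andP[? ?] /andP[? ?]; lra.
Qed.

(** Along [retr u w - u = w - k u], with [k] close to half of [b w w / mu], the
    first order term [- k dphi u u] combines with [d2phi u w w / 2] into half of the
    Hessian along the sphere; everything else is of order [om |w| ^ 2]. *)
Lemma sphere_expansion (L om : R) u w :
  1 <= L -> mu^-1 <= L -> `|u| <= L -> `|dphi u| <= L -> `|d2phi u| <= L ->
  b u u = mu -> b u w = 0 -> L ^+ 2 * `|w| <= 1 -> `|w| <= om ->
  (forall t : R, 0 <= t <= 1 ->
    `|d2phi (u + t *: (retr u w - u)) - d2phi u| <= om) ->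
  phi (retr u w) <= phi u + dphi u w + sphere_hessian u w w / 2 +
    6 * L ^+ 5 * om * `|w| ^+ 2.
Proof.
move=> L1 muL uL dL d2L uS uw wL wom /(taylor2_le phiC2).
have [w1 sL s01 zw] := retr_dist L1 muL uL wL.
have /andP[k0 k1] := sqrt_expansion s01; have /andP[s0 s1] := s01.
rewrite addrC subrK.
have L0 : 0 < L := lt_le_trans ltr01 L1.
have om0 : 0 <= om by apply: le_trans wom.
have zom : om * `|retr u w - u| ^+ 2 <= om * (2 * `|w|) ^+ 2.
  by rewrite ler_wpM2l// lerXn2r ?nnegrE ?mulr_ge0.
have Ez : retr u w - u = w - (1 - Num.sqrt (1 - b w w / mu)) *: u.
  by rewrite /retr scalerBl scale1r opprB addrAC addrC addrA.
rewrite /sphere_hessian uS.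
have -> : dphi u u / mu * b w w = dphi u u * (b w w / mu) by rewrite mulrAC -mulrA.
set s := b w w / mu in k0 k1 sL s0 s1 Ez *; set k := 1 - _ in k0 k1 Ez.
set z := retr u w - u in zom Ez *.
have -> : dphi u z = dphi u w - k * dphi u u by rewrite Ez clinBZ.
have -> : d2phi u z z = d2phi u w w - k * d2phi u w u - k * d2phi u u w
    + k ^+ 2 * d2phi u u u by rewrite Ez clin2BZ !clinBZ; ring.
have := clin_le dL uL; have := clin2_le d2L (lexx `|w|) uL.
have := clin2_le d2L uL (lexx `|w|); have := clin2_le d2L uL uL.
move: zom (dphi u w) (d2phi u w w) (dphi u u)
  (d2phi u w u) (d2phi u u w) (d2phi u u u).
move: (om * `|z| ^+ 2) => zz.
move: (`|w|) (normr_ge0 w) w1 wom sL => X X0 X1 Xom sL zzX.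
move=> Aw Bww Au Bwu Buw Buu hBuu hBuw hBwu hAu.
move=> /le_trans; apply.
have := expansion_arith L1 om0 X0 X1 Xom s0 s1 sL k0 k1 zzX hAu hBwu hBuw hBuu.
lra.
Qed.

(** A direction that is tangent at [u0] becomes tangent at the nearby point [u]
    after a projection that moves it by [O(om)]. Slope and curvature along it
    therefore change by [O(om)] only, and the descent properties at [u0] persist
    near [u0]. *)
Lemma tproj_tilt (L om : R) u u0 v :
  1 <= L -> mu^-1 <= L -> `|u| <= L -> `|u0| <= L ->
  `|dphi u| <= L -> `|dphi u0| <= L -> `|d2phi u| <= L -> `|d2phi u0| <= L ->
  `|u - u0| <= om -> om <= 1 ->
  `|dphi u - dphi u0| <= om -> `|d2phi u - d2phi u0| <= om ->
  b u u = mu -> b u0 u0 = mu -> b u0 v = 0 -> `|v| <= 1 ->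
  [/\ `|tproj u v| <= 2 * L ^+ 2,
    dphi u (tproj u v) <= dphi u0 v + 3 * L ^+ 3 * om,
    sphere_hessian u (tproj u v) (tproj u v) <=
      sphere_hessian u0 v v + 18 * L ^+ 7 * om &
    sphere_hessian u (tproj u v) (tproj u v) <= 8 * L ^+ 7].
Proof.
move=> L1 muL uL u0L dL dL0 d2L d2L0 uu0 om1 dom d2om uS u0S u0v v1.
have L0 : 0 <= L := le_trans ler01 L1.
have om0 : 0 <= om by apply: le_trans uu0.
have mui : 0 <= mu^-1 by rewrite invr_ge0 ltW.
set p := tproj u v.
have pv : `|p - v| <= L ^+ 2 * om.
  have -> : p - v = - ((b u v / mu) *: u) by rewrite /p /tproj addrAC subrr sub0r.
  rewrite normrN normrZ normrM [`|mu^-1|]ger0_norm//.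
  have -> : L ^+ 2 * om = om * L * L by ring.
  apply: ler_pM; rewrite ?mulr_ge0//; apply: ler_pM => //.
  have -> : b u v = b (u - u0) v by rewrite formBl u0v subr0.
  by apply: le_trans (b_le _ _) _; rewrite -[om]mulr1; exact: ler_pM.
clearbody p; have L2 : 1 <= L ^+ 2 by rewrite exprn_ege1.
have p2 : `|p| <= 2 * L ^+ 2.
  rewrite -(subrK v p); apply: le_trans (ler_normD _ _) _.
  have : L ^+ 2 * om <= L ^+ 2 by rewrite ler_piMr// exprn_ge0.
  by move: pv v1 L2; lra.
have lele i j : (i <= j)%N -> L ^+ i <= L ^+ j by move=> ij; rewrite ler_weXn2l.
have Lom i j : (i <= j)%N -> L ^+ i * om <= L ^+ j * om.
  by move=> ij; rewrite ler_wpM2r// lele.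
have hA0 : `|dphi u0 u0 / mu| <= L * L * L.
  by rewrite normrM [`|mu^-1|]ger0_norm//; apply: ler_pM => //; exact: clin_le.
have hA : `|dphi u u / mu| <= L * L * L.
  by rewrite normrM [`|mu^-1|]ger0_norm//; apply: ler_pM => //; exact: clin_le.
have hAA : `|dphi u u / mu - dphi u0 u0 / mu| <= (om * L + L * om) * L.
  rewrite -mulrBl normrM [`|mu^-1|]ger0_norm//; apply: ler_pM => //.
  have -> : dphi u u - dphi u0 u0 = (dphi u - dphi u0) u + dphi u0 (u - u0).
    by rewrite clin_subE linearB addrA subrK.
  by apply: le_trans (ler_normD _ _) _; apply: lerD; exact: clin_le.
have hbpp : `|b p p| <= 2 * L ^+ 2 * (2 * L ^+ 2).
  by apply: le_trans (b_le _ _) _; exact: ler_pM.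
have hb1 : `|b (p - v) p| <= L ^+ 2 * om * (2 * L ^+ 2).
  by apply: le_trans (b_le _ _) _; exact: ler_pM.
have hb2 : `|b v (p - v)| <= 1 * (L ^+ 2 * om).
  by apply: le_trans (b_le _ _) _; exact: ler_pM.
split => //.
- have -> : dphi u p = dphi u0 v + ((dphi u - dphi u0) p + dphi u0 (p - v)).
    by rewrite clin_subE linearB /=; ring.
  rewrite lerD2l; apply: le_trans (ler_norm _) _; apply: le_trans (ler_normD _ _) _.
  have := clin_le dom p2; have := clin_le dL0 pv; have := Lom 2%N 3%N isT.
  by lra.
- rewrite /sphere_hessian uS u0S.
  have -> : d2phi u p p = d2phi u0 v v + ((d2phi u - d2phi u0) p p +
      d2phi u0 (p - v) p + d2phi u0 v (p - v)).
    rewrite clin2_subE -(scale1r v) !(clin2BZ, clinBZ) scale1r; ring.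
  have -> : dphi u u / mu * b p p = dphi u0 u0 / mu * b v v +
      ((dphi u u / mu - dphi u0 u0 / mu) * b p p +
       dphi u0 u0 / mu * (b (p - v) p + b v (p - v))).
    rewrite formBl formBr (b_sym v p); ring.
  have h1 := clin2_le d2om p2 p2; have h2 := clin2_le d2L0 pv p2.
  have h3 := clin2_le d2L0 v1 pv.
  have h4 : `|(dphi u u / mu - dphi u0 u0 / mu) * b p p| <=
    (om * L + L * om) * L * (2 * L ^+ 2 * (2 * L ^+ 2)).
    by rewrite normrM; exact: ler_pM.
  have h5 : `|dphi u0 u0 / mu * (b (p - v) p + b v (p - v))| <=
    L * L * L * (L ^+ 2 * om * (2 * L ^+ 2) + 1 * (L ^+ 2 * om)).
    rewrite normrM; apply: ler_pM => //.
    by apply: le_trans (ler_normD _ _) _; exact: lerD.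
  have := Lom 6%N 7%N isT; have := Lom 4%N 7%N isT;
  have := Lom 5%N 7%N isT; have := Lom 3%N 7%N isT.
  move: h1 h2 h3 h4 h5; rewrite !ler_norml.
  by move=> /andP[_ ?] /andP[_ ?] /andP[_ ?] /andP[? _] /andP[? _] ? ? ? ?; lra.
- rewrite /sphere_hessian uS.
  have h1 := clin2_le d2L p2 p2.
  have h2 : `|dphi u u / mu * b p p| <= L * L * L * (2 * L ^+ 2 * (2 * L ^+ 2)).
    by rewrite normrM; exact: ler_pM.
  have := lele 5%N 7%N isT.
  by move: h1 h2; rewrite !ler_norml => /andP[_ ?] /andP[? _] ?; lra.
Qed.

(** The two ways of descending, in terms of the slope [dp] and the curvature [h]
    along the direction. In the first one the slope dominates the curvature because
    [rho] is small. In the second one the slope may have an unfavourable but tiny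
    value [sg], and the curvature makes the value decrease quadratically. *)
Lemma move_arith (L om eta rho t sg dp h : R) :
  1 <= L -> 0 <= om -> om <= 1 -> 200 * L ^+ 9 * om <= eta ->
  0 < rho -> 2 * L ^+ 2 * rho <= om -> 0 <= t -> t <= 1 -> 0 <= sg ->
  (dp <= - (3 * eta) + 3 * L ^+ 3 * om /\ h <= 8 * L ^+ 7) \/
  (h <= - eta + 18 * L ^+ 7 * om /\ dp <= sg) ->
  t * rho * dp + (t * rho) ^+ 2 * h / 2 + 24 * (L ^+ 9 * om) * (t * rho) ^+ 2 <=
  rho * sg - eta / 4 * (t * rho) ^+ 2.
Proof.
move=> L1 om0 om1 ometa rho0 rhoom t0 t1 sg0 hcase.
have L0 : 0 <= L := le_trans ler01 L1.
have tr0 : 0 <= t * rho by rewrite mulr_ge0// ltW.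
have L9 i : (i <= 9)%N -> L ^+ i * om <= L ^+ 9 * om.
  by move=> i9; rewrite ler_wpM2r// ler_weXn2l.
have L79 : L ^+ 7 <= L ^+ 9 by rewrite ler_weXn2l.
have LO3 := L9 3%N isT; have LO7 := L9 7%N isT.
have LO0 : 0 <= L ^+ 9 * om by rewrite mulr_ge0// exprn_ge0.
have rsg : t * rho * sg <= rho * sg by rewrite ler_wpM2r// ler_piMl// ltW.
case: hcase => [[h1 h2]|[h1 h2]]; last first.
  have : t * rho * dp <= t * rho * sg by rewrite ler_wpM2l.
  have : (t * rho) ^+ 2 * (h / 2 + 24 * (L ^+ 9 * om) + eta / 4) <= 0.
    by rewrite mulr_ge0_le0 ?exprn_ge0//; lra.
  by move: rsg; set T := (t * rho) ^+ 2; lra.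
have rL9 : rho * L ^+ 9 <= om * L ^+ 9.
  rewrite ler_wpM2r ?exprn_ge0//; apply: le_trans rhoom.
  rewrite ler_peMl ?ltW//; have : 1 <= L ^+ 2 by rewrite exprn_ege1.
  by lra.
have rs0 : 0 <= rho * sg by rewrite mulr_ge0// ltW.
suff : t * rho * (dp + t * rho * (h / 2 + 24 * (L ^+ 9 * om) + eta / 4)) <= 0.
  by move: rs0; lra.
rewrite mulr_ge0_le0//.
have eta0 : 0 <= eta by lra.
have L9e : L ^+ 9 * om <= L ^+ 9 by rewrite ler_piMr// exprn_ge0.
have : t * rho * (h / 2 + 24 * (L ^+ 9 * om) + eta / 4) <=
    rho * (28 * L ^+ 9 + eta / 4).
  apply: (@le_trans _ _ (t * rho * (28 * L ^+ 9 + eta / 4))).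
    by rewrite ler_wpM2l//; lra.
  rewrite ler_wpM2r//; last by rewrite ler_piMl// ltW.
  by apply: addr_ge0; rewrite ?mulr_ge0 ?exprn_ge0// ?divr_ge0.
have : rho * eta <= eta.
  rewrite ler_piMl//; have : 1 <= L ^+ 2 by rewrite exprn_ege1.
  move=> L2; apply: le_trans om1; apply: le_trans rhoom.
  rewrite ler_peMl ?ltW//; lra.
have -> : rho * (28 * L ^+ 9 + eta / 4) = 28 * (rho * L ^+ 9) + rho * eta / 4 by field.
lra.
Qed.

(** The gain [eta * rho ^+ 2 / 4 * t ^+ 2] is the one that negative curvature
    provides. A steep direction gains more, being linear in [t]; using the same
    bound for both keeps the later bookkeeping independent of the kind of point. *)
Lemma sphere_move (L om eta rho t sg : R) u u0 v :
  1 <= L -> mu^-1 <= L -> `|u| <= L -> `|u0| <= L ->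
  `|dphi u| <= L -> `|dphi u0| <= L -> `|d2phi u| <= L -> `|d2phi u0| <= L ->
  `|u - u0| <= om -> om <= 1 ->
  `|dphi u - dphi u0| <= om -> `|d2phi u - d2phi u0| <= om ->
  b u u = mu -> b u0 u0 = mu -> b u0 v = 0 -> `|v| <= 1 ->
  200 * L ^+ 9 * om <= eta -> eta <= 1 -> 0 < rho -> 2 * L ^+ 2 * rho <= om ->
  (forall z, `|z| <= 4 * L ^+ 2 * rho -> `|d2phi (u + z) - d2phi u| <= om) ->
  0 <= t <= 1 -> 0 <= sg ->
  (dphi u0 v <= - (3 * eta) \/
   sphere_hessian u0 v v <= - eta /\ dphi u (tproj u v) <= sg) ->
  [/\ b (retr u ((t * rho) *: tproj u v)) (retr u ((t * rho) *: tproj u v)) = mu,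
      `|retr u ((t * rho) *: tproj u v) - u| <= 4 * L ^+ 2 * rho &
      phi (retr u ((t * rho) *: tproj u v)) <=
        phi u + rho * sg - eta * rho ^+ 2 / 4 * t ^+ 2].
Proof.
move=> L1 muL uL u0L dL dL0 d2L d2L0 uu0 om1 dom d2om uS u0S u0v v1.
move=> ometa eta1 rho0 rhoom hz /andP[t0 t1] sg0 hcase.
have [p2 hd hh hh'] := tproj_tilt L1 muL uL u0L dL dL0 d2L d2L0 uu0 om1 dom d2om
  uS u0S u0v v1.
have up := form_tproj v uS; set p := tproj u v in p2 hd hh hh' hcase up *; clearbody p.
have L0 : 0 <= L := le_trans ler01 L1.
have L2 : 1 <= L ^+ 2 by rewrite exprn_ege1.
have om0 : 0 <= om by apply: le_trans uu0.
have tr0 : 0 <= t * rho by rewrite mulr_ge0// ltW.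
have tr1 : t * rho <= rho by rewrite ler_piMl// ltW.
set w := (t * rho) *: p.
have uw : b u w = 0.
  by rewrite /w -[_ *: p]addr0 form_linr up mulr0 add0r -(subrr p) formBr subrr.
have nw : `|w| <= t * rho * (2 * L ^+ 2) by rewrite normrZ ger0_norm// ler_wpM2l.
have nw' : `|w| <= 2 * L ^+ 2 * rho.
  by apply: le_trans nw _; rewrite mulrC ler_wpM2l// mulr_ge0// exprn_ge0.
have wom : `|w| <= om by exact: le_trans rhoom.
have L9 i : (i <= 9)%N -> L ^+ i * om <= L ^+ 9 * om.
  by move=> i9; rewrite ler_wpM2r// ler_weXn2l.
have wL : L ^+ 2 * `|w| <= 1.
  apply: (@le_trans _ _ (L ^+ 2 * om)); first by rewrite ler_wpM2l// exprn_ge0.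
  by move: (L9 2%N isT) (mulr_ge0 (exprn_ge0 9 L0) om0) ometa eta1; lra.
have [w1 sL s01 zw] := retr_dist L1 muL uL wL.
have zr : `|retr u w - u| <= 4 * L ^+ 2 * rho.
  have -> : 4 * L ^+ 2 * rho = 2 * (2 * L ^+ 2 * rho) by ring.
  by apply: le_trans zw _; rewrite ler_pM2l.
split => //.
  apply: retr_sphere => //; have /andP[_] := s01.
  by rewrite ler_pdivrMr// mul1r.
have hseg (s : R) : 0 <= s <= 1 -> `|d2phi (u + s *: (retr u w - u)) - d2phi u| <= om.
  move=> /andP[s0 s1]; apply: hz; rewrite normrZ ger0_norm//.
  by apply: le_trans zr; rewrite ler_piMl.
apply: le_trans (sphere_expansion L1 muL uL dL d2L uS uw wL wom hseg) _.
have -> : dphi u w = t * rho * dphi u p by rewrite /w clinZ.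
have -> : sphere_hessian u w w = (t * rho) ^+ 2 * sphere_hessian u p p.
  rewrite /sphere_hessian /w.
  have bZ : b ((t * rho) *: p) ((t * rho) *: p) = (t * rho) ^+ 2 * b p p.
    rewrite -[X in b X _]addr0 b_lin -(subrr p) formBl subrr addr0.
    by rewrite b_sym -[X in b X _]addr0 b_lin -(subrr p) formBl subrr addr0; ring.
  by rewrite bZ clin2Z clinZ; ring.
have hw2 : 6 * L ^+ 5 * om * `|w| ^+ 2 <= 24 * (L ^+ 9 * om) * (t * rho) ^+ 2.
  have -> : 24 * (L ^+ 9 * om) * (t * rho) ^+ 2 =
    6 * L ^+ 5 * om * (t * rho * (2 * L ^+ 2)) ^+ 2 by ring.
  rewrite ler_wpM2l ?mulr_ge0 ?exprn_ge0//.
  apply: lerXn2r => //; rewrite nnegrE ?normr_ge0//.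
  by rewrite mulr_ge0// mulr_ge0// exprn_ge0.
have -> : eta * rho ^+ 2 / 4 * t ^+ 2 = eta / 4 * (t * rho) ^+ 2 by field.
have : t * rho * dphi u p + (t * rho) ^+ 2 * sphere_hessian u p p / 2 +
    24 * (L ^+ 9 * om) * (t * rho) ^+ 2 <= rho * sg - eta / 4 * (t * rho) ^+ 2.
  apply: move_arith => //; case: hcase => [d3|[h1 h2]]; [left|right]; split => //.
    by apply: le_trans hd _; rewrite lerD2r.
  by apply: le_trans hh _; rewrite lerD2r.
by move: hw2; lra.
Qed.

(** * Continuous families of descent directions *)

Lemma lincomb_lipschitz k (w : 'I_k -> E) (x y : 'rV[R]_k) :
  `|\sum_i x 0 i *: w i - \sum_i y 0 i *: w i| <= (\sum_i `|w i|) * `|x - y|.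
Proof.
rewrite -sumrB mulr_suml.
apply: le_trans (ler_norm_sum _ _ _) _; apply: ler_sum => j _.
rewrite -scalerBl normrZ mulrC ler_wpM2l//.
by have := mxnorm_ge (x - y) ord0 j; rewrite !mxE.
Qed.

(** The norm of the linear combination attains a positive minimum on the compact
    unit sphere of the coefficients. *)
Lemma lin_indep_lower_bound k (w : 'I_k.+1 -> E) : lin_indep w ->
  exists2 m : R, 0 < m &
    forall a : 'rV[R]_k.+1, m * `|a| <= `|\sum_i a 0 i *: w i|.
Proof.
move=> w_free; pose S := [set a : 'rV[R]_k.+1 | `|a| = 1].
pose h (a : 'rV[R]_k.+1) := `|\sum_i a 0 i *: w i|.
have h_cont : continuous h.
  apply: (@lipschitz_continuous _ _ R^o _ (\sum_i `|w i|)) => x y.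
  exact: le_trans (ler_dist_dist _ _) (lincomb_lipschitz _ _ _).
have S_compact : compact S.
  apply: bounded_closed_compact.
    by exists 1; split=> // M M1 a /= ->; exact: ltW.
  have -> : S = (@Num.norm _ 'rV[R]_k.+1) @^-1` [set 1] by [].
  apply: closed_comp; last exact: closed_eq.
  by move=> a _; exact: norm_continuous.
have S_neq0 : S !=set0.
  pose e : 'rV[R]_k.+1 := const_mx 1.
  have e0 : `|e| != 0.
    rewrite normr_eq0; apply/eqP.
    by move=> /matrixP/(_ 0 0)/eqP; rewrite !mxE oner_eq0.
  exists (`|e|^-1 *: e) => /=.
  by rewrite /S /= normrZ ger0_norm ?invr_ge0// mulVf.
have [a0] := EVT_min_rV S_neq0 S_compact (continuous_subspaceT h_cont).
rewrite inE => /= a01 a0min.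
exists (h a0).
  rewrite normr_gt0; apply/eqP => /w_free a00.
  have : `|a0| == 0 by rewrite normr_eq0; apply/eqP/rowP => j; rewrite a00 mxE.
  by rewrite a01 oner_eq0.
move=> a; have [->|a_neq0] := eqVneq a 0; first by rewrite normr0 mulr0.
have na : 0 < `|a| by rewrite normr_gt0.
have /a0min : (`|a|^-1 *: a) \in S.
  by rewrite inE /S /= normrZ ger0_norm ?invr_ge0// mulVf ?gt_eqF.
have -> : h (`|a|^-1 *: a) = `|a|^-1 * h a.
  rewrite /h -[X in X * _]ger0_norm ?invr_ge0// -normrZ scaler_sumr.
  by congr (`|_|); apply: eq_bigr => j _; rewrite mxE scalerA.
by rewrite mulrC ler_pdivlMr.
Qed.

Lemma tproj_cvg (T : Type) (F : set_system T) {FF : Filter F} (f g : T -> E) (x y : E) :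
  f @ F --> x -> g @ F --> y -> (fun t => tproj (f t) (g t)) @ F --> tproj x y.
Proof.
move=> fx gy; apply: cvgB => //; apply: cvgZ => //.
by apply: cvgM; [exact: (form_cvg fx gy)|exact: cvg_cst].
Qed.

Lemma retr_cvg (T : Type) (F : set_system T) {FF : Filter F} (f g : T -> E) (x y : E) :
  f @ F --> x -> g @ F --> y -> (fun t => retr (f t) (g t)) @ F --> retr x y.
Proof.
move=> fx gy; apply: cvgD => //; apply: cvgZ => //.
apply: (@cvg_comp _ _ _ (fun t => 1 - b (g t) (g t) / mu) Num.sqrt).
  apply: cvgB; first exact: cvg_cst.
  by apply: cvgM; [exact: (form_cvg gy gy)|exact: cvg_cst].
exact: sqrt_continuous.
Qed.

Variables (n : nat) (D : set 'rV[R]_n).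
Hypothesis D_compact : compact D.

(** The first of the two ways in which a point can fail to be almost critical of
    almost index at most [n]. *)
Definition steep u eta := exists v, [/\ b u v = 0, `|v| <= 1 & dphi u v <= - (3 * eta)].

(** The second way, with the subspace given by a basis of [n.+1] vectors since only
    that many directions are used. *)
Definition negative_frame u eta := exists w : 'I_n.+1 -> E, lin_indep w /\
  forall a : 'I_n.+1 -> R, let v := \sum_i a i *: w i in
    b u v = 0 /\ sphere_hessian u v v <= - eta * `|v| ^+ 2.

(** At a steep point one direction serves for all [x]. On a negative frame every
    direction has negative curvature, but the slope of [phi] at [f x] may have
    either sign; the slopes along the [n.+1] vectors of the frame form a map from
    R^n to R^(n+1), and [nonvanishing_approx] supplies coefficients, depending
    continuously on [x], along which the slope is almost nonpositive. *)
Lemma descent_field (f : 'rV[R]_n -> E) u0 eta sg :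
  {within D, continuous f} -> 0 < sg -> steep u0 eta \/ negative_frame u0 eta ->
  exists v : 'rV[R]_n -> E, {within D, continuous v} /\
    forall x, D x -> [/\ b u0 (v x) = 0, `|v x| <= 1 &
      dphi u0 (v x) <= - (3 * eta) \/
      sphere_hessian u0 (v x) (v x) <= - eta /\
      dphi (f x) (tproj (f x) (v x)) <= sg].
Proof.
move=> /subspace_continuousP fD sg0 [[v [u0v v1 dv]]|[w [w_free wneg]]].
  exists (fun=> v); split; first exact/continuous_subspaceT/cst_continuous.
  by move=> x _; split=> //; left.
have [m m0 hm] := lin_indep_lower_bound w_free.
pose g x i := dphi (f x) (tproj (f x) (w i)).
have gD i : {within D, continuous (g^~ i)}.
  apply/subspace_continuousP => x Dx; apply: clin_eval_cvg.
    apply: (@cvg_comp _ _ _ f dphi); first exact: fD.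
    exact: (is_C2_dcontinuous phiC2).
  by apply: tproj_cvg; [exact: fD|exact: cvg_cst].
have [a [a_cont a_neq0 ag]] := nonvanishing_approx D_compact gD (mulr_gt0 sg0 m0).
pose v x := \sum_i a x 0 i *: w i.
have nv x : D x -> 0 < `|v x|.
  move=> Dx; apply: lt_le_trans (hm _).
  by rewrite mulr_gt0// normr_gt0 a_neq0.
have v_cont : continuous v.
  move=> x; apply: (@cvg_comp _ _ _ a (fun y : 'rV[R]_n.+1 => \sum_i y 0 i *: w i)).
    exact: a_cont.
  exact: (lipschitz_continuous (lincomb_lipschitz w)).
exists (fun x => `|v x|^-1 *: v x); split.
  apply/subspace_continuousP => x Dx; apply: cvg_within_filter.
  apply: cvgZ; last exact: v_cont.
  by apply: cvgV; [rewrite gt_eqF ?nv|apply: cvg_norm; exact: v_cont].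
move=> x Dx; have vx0 := nv x Dx.
have nE : `| `|v x|^-1 *: v x| = 1 by rewrite normrZ ger0_norm ?invr_ge0// mulVf ?gt_eqF.
have vE : `|v x|^-1 *: v x = \sum_i (`|v x|^-1 * a x 0 i) *: w i.
  by rewrite scaler_sumr; apply: eq_bigr => i _; rewrite scalerA.
split; rewrite ?nE//.
  by rewrite vE; have [] := wneg (fun i => `|v x|^-1 * a x 0 i).
right; split.
  have [_] := wneg (fun i => `|v x|^-1 * a x 0 i).
  by rewrite /= -vE nE expr1n mulr1.
rewrite vE.
have -> : dphi (f x) (tproj (f x) (\sum_i (`|v x|^-1 * a x 0 i) *: w i)) =
  `|v x|^-1 * \sum_i a x 0 i * g x i.
  have lin_t : linear (fun z => dphi (f x) (tproj (f x) z)).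
    move=> k y z; rewrite /tproj form_linr mulrDl scalerDl opprD addrACA.
    by rewrite -mulrA -scalerA -scalerBr linearP.
  pose T : {linear E -> R} := HB.pack (fun z => dphi (f x) (tproj (f x) z))
    (GRing.isLinear.Build R E R _ _ lin_t).
  rewrite -[LHS]/(T _) linear_sum mulr_sumr; apply: eq_bigr => i _.
  by rewrite linearZ /= /GRing.scale /= mulrA.
rewrite ler_pdivrMl//; apply: le_trans (ag x Dx) _.
by rewrite -mulrA mulrC ler_wpM2r// ltW.
Qed.

(** * Deforming a compact family below its minimax level *)

(** [delta] is a scale on which the derivatives oscillate by at most [om], which is
    small compared with the thresholds [eta]; up to a constant [rho] is the
    length of one move, a small fraction of [delta]. *)
Variables (L om eta rho r delta : R).
Hypotheses (L_ge1 : 1 <= L) (muL : mu^-1 <= L) (rL : r <= L).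
Hypothesis bounds : forall u, `|u| < r -> `|dphi u| <= L /\ `|d2phi u| <= L.
Hypothesis modulus : forall u v, `|u| < r -> `|v| < r -> `|u - v| <= delta ->
  `|dphi u - dphi v| <= om /\ `|d2phi u - d2phi v| <= om.
Hypotheses (delta_om : delta <= om) (om_le1 : om <= 1).
Hypotheses (om_eta : 200 * L ^+ 9 * om <= eta) (eta_le1 : eta <= 1).
Hypotheses (rho_gt0 : 0 < rho) (rho_delta : 4 * L ^+ 2 * rho <= delta / 4).

(** Moves [f] along the field of [descent_field], with [psi] as a throttle. The
    loss [s0] is the price for the slopes that are not exactly nonpositive, and can
    be prescribed as small as desired. *)
Lemma local_descent (f : 'rV[R]_n -> E) (psi : 'rV[R]_n -> R) u0 s0 :
  {within D, continuous f} -> (forall x, D x -> b (f x) (f x) = mu) ->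
  continuous psi -> (forall x, 0 <= psi x <= 1) ->
  b u0 u0 = mu -> `|u0| < r - 1 ->
  (forall x, D x -> psi x != 0 -> `|f x - u0| <= delta / 2) ->
  steep u0 eta \/ negative_frame u0 eta -> 0 < s0 ->
  exists g : 'rV[R]_n -> E, {within D, continuous g} /\ forall x, D x ->
    [/\ b (g x) (g x) = mu, psi x = 0 -> g x = f x,
        `|g x - f x| <= 4 * L ^+ 2 * rho &
        phi (g x) <= phi (f x) + s0 - eta * rho ^+ 2 / 4 * psi x ^+ 2].
Proof.
move=> fD fS psi_cont psi01 u0S u0r fu0 u0dir s0_gt0.
have [v [/subspace_continuousP vD hv]] :=
  descent_field fD (divr_gt0 s0_gt0 rho_gt0) u0dir.
have L0 : 0 <= L := le_trans ler01 L_ge1.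
have Lr : 0 <= L ^+ 2 * rho by rewrite mulr_ge0 ?exprn_ge0// ltW.
exists (fun x => retr (f x) ((psi x * rho) *: tproj (f x) (v x))); split.
  move/subspace_continuousP in fD.
  apply/subspace_continuousP => x Dx; apply: retr_cvg; first exact: fD.
  apply: cvgZ; last by apply: tproj_cvg; [exact: fD|exact: vD].
  by apply: cvgM; [apply: cvg_within_filter; exact: psi_cont|exact: cvg_cst].
move=> x Dx; have [psi0|psi_neq0] := eqVneq (psi x) 0.
  rewrite psi0 mul0r scale0r retr0 fS// subrr normr0 expr0n mulr0 subr0.
  by split=> //; [lra|rewrite lerDl ltW].
have [u0v v1 hcase] := hv x Dx.
have fxu0 := fu0 x Dx psi_neq0.
have [hrd hdo ho1] := And3 rho_delta delta_om om_le1.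
have delta0 : 0 <= delta by move: Lr hrd; lra.
have delta1 : delta <= 1 by lra.
have fxr : `|f x| < r - 1 / 2.
  by rewrite -(subrK u0 (f x)); apply: le_lt_trans (ler_normD _ _) _; lra.
have fxr' : `|f x| < r by lra.
have u0r' : `|u0| < r by lra.
have fxu0' : `|f x - u0| <= delta by lra.
have [b1 b2] := bounds fxr'; have [b3 b4] := bounds u0r'.
have [m1 m2] := modulus fxr' u0r' fxu0'.
have s0rho : 0 <= s0 / rho by rewrite ltW// divr_gt0.
have near_f z : `|z| <= 4 * L ^+ 2 * rho -> `|d2phi (f x + z) - d2phi (f x)| <= om.
  move=> hz; have [] := @modulus (f x + z) (f x) _ _ _ => //.
    by apply: le_lt_trans (ler_normD _ _) _; lra.
  by rewrite addrAC subrr add0r; lra.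
have fxL : `|f x| <= L := le_trans (ltW fxr') rL.
have u0L : `|u0| <= L := le_trans (ltW u0r') rL.
have fxuom : `|f x - u0| <= om := le_trans fxu0' delta_om.
have rho_om : 2 * L ^+ 2 * rho <= om by lra.
have [h1 h2 h3] := sphere_move L_ge1 muL fxL u0L b1 b3 b2 b4 fxuom
  om_le1 m1 m2 (fS x Dx) u0S u0v v1 om_eta eta_le1 rho_gt0 rho_om near_f (psi01 x)
  s0rho hcase.
split => //; first by move=> p0; rewrite p0 eqxx in psi_neq0.
by move: h3; rewrite [rho * (s0 / rho)]mulrC divfK ?gt_eqF.
Qed.

(** The local deformations are composed one after the other. The number [c] of
    bumps that act at [x] bounds the displacement of [f x], which keeps it within
    reach of all later base points, and the accumulated loss; a single bump equal to 1
    at [x] secures the full gain. *)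
Lemma sequential_descent (I : eqType) (psi : I -> 'rV[R]_n -> R) (u : I -> E)
    (N : nat) (s0 : R) (f : 'rV[R]_n -> E) (s : seq I) :
  N%:R * (4 * L ^+ 2 * rho) <= delta / 4 -> 0 < s0 ->
  {within D, continuous f} -> (forall x, D x -> b (f x) (f x) = mu) ->
  (forall k, continuous (psi k)) -> (forall k x, 0 <= psi k x <= 1) ->
  (forall x, (count (fun k => psi k x != 0%R) s <= N)%N) ->
  (forall k, k \in s -> [/\ b (u k) (u k) = mu, `|u k| < r - 1,
    forall x, D x -> psi k x != 0 -> `|f x - u k| <= delta / 4 &
    steep (u k) eta \/ negative_frame (u k) eta]) ->
  exists g : 'rV[R]_n -> E, {within D, continuous g} /\ forall x, D x ->
    let c := (count (fun k => psi k x != 0%R) s)%:R in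
    [/\ b (g x) (g x) = mu, `|g x - f x| <= c * (4 * L ^+ 2 * rho) &
        phi (g x) <= phi (f x) + c * s0 -
          (if has (fun k => psi k x == 1) s then eta * rho ^+ 2 / 4 else 0)].
Proof.
move=> Nrho s0_gt0 fD fS psi_cont psi01.
have L0 : 0 <= L := le_trans ler01 L_ge1.
have step0 : 0 <= 4 * L ^+ 2 * rho by rewrite !mulr_ge0 ?exprn_ge0// ltW.
have eta0 : 0 <= eta.
  have om0 : 0 <= om by move: rho_delta delta_om step0; lra.
  by apply: le_trans om_eta; rewrite !mulr_ge0// exprn_ge0.
have gain0 : 0 <= eta * rho ^+ 2 / 4.
  by rewrite divr_ge0// mulr_ge0// exprn_ge0// ltW.
elim: s => [_ _|k s IH countN hs].
  exists f; split=> // x Dx /=.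
  by rewrite subrr normr0 !mul0r addr0 subr0; split=> //; exact: fS.
have [ukS ukr fuk ukdir] := hs k (mem_head k s).
have [x|k' k's|g [gD hg]] := IH.
- by apply: leq_trans (countN x); rewrite leq_addl.
- by apply: hs; rewrite inE k's orbT.
have guk x : D x -> psi k x != 0 -> `|g x - u k| <= delta / 2.
  move=> Dx kx; have [_ gf _] := hg x Dx.
  apply: le_trans (ler_distD (f x) _ _) _.
  have := fuk x Dx kx; have : (count (fun k => psi k x != 0%R) s)%:R * (4 * L ^+ 2 * rho) <=
    N%:R * (4 * L ^+ 2 * rho).
    by rewrite ler_wpM2r// ler_nat; apply: leq_trans (countN x); rewrite leq_addl.
  by move: gf; lra.
have gS x : D x -> b (g x) (g x) = mu by move=> /hg[].
have [g' [g'D hg']] := local_descent gD gS (psi_cont k) (psi01 k) ukS ukr guk ukdir s0_gt0.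
exists g'; split => // x Dx /=.
have [_ gf gphi] := hg x Dx; have [g'S g'eq g'g g'phi] := hg' x Dx.
rewrite natrD; split => //.
  have [k0|k0] := eqVneq (psi k x) 0; first by rewrite g'eq//= add0r.
  rewrite mulrDl mul1r; apply: le_trans (ler_distD (g x) _ _) _.
  exact: lerD.
have psi2 : 0 <= eta * rho ^+ 2 / 4 * psi k x ^+ 2 by rewrite mulr_ge0// sqr_ge0.
have [k0|k0] := eqVneq (psi k x) 0.
  rewrite g'eq//= k0 [0 == 1]eq_sym oner_eq0 /= add0r; exact: gphi.
have [k1|k1] := eqVneq (psi k x) 1.
  rewrite k1 expr1n mulr1 in g'phi => /=.
  by move: gphi; case: ifP => _ /=; lra.
by move: gphi g'phi => /=; rewrite mulrDl mul1r; lra.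
Qed.

(** Only the bumps that meet the set where [phi (f x) >= c - eps] are used, each
    with a base point in that set. By the choice of the mesh they do not reach the
    points where [phi (f x) <= c - 2 * eps]. High points gain [4 * eps], while no
    point loses more than [eps / 2]. *)
Lemma push_below (f : 'rV[R]_n -> E) (c eps : R) :
  (4 ^ n)%:R * (4 * L ^+ 2 * rho) <= delta / 4 ->
  0 < eps -> 4 * eps <= eta * rho ^+ 2 / 4 ->
  {within D, continuous f} -> (forall x, D x -> b (f x) (f x) = mu) ->
  (forall x, D x -> phi (f x) <= c + eps) ->
  (forall x, D x -> c - eps <= phi (f x) -> `|f x| < r - 1 /\
    (steep (f x) eta \/ negative_frame (f x) eta)) ->
  exists g : 'rV[R]_n -> E, {within D, continuous g} /\ forall x, D x ->
    [/\ b (g x) (g x) = mu, phi (f x) <= c - 2 * eps -> g x = f x &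
        phi (g x) <= c - eps / 2].
Proof.
move=> Nrho eps0 gain fD fS f_le f_high.
have L2 : 0 < L ^+ 2 by rewrite exprn_gt0// (lt_le_trans ltr01).
have delta4 : 0 < delta / 4.
  by apply: lt_le_trans rho_delta; apply: mulr_gt0 => //; apply: mulr_gt0.
have phifD : {within D, continuous (phi \o f)}.
  move/subspace_continuousP in fD; apply/subspace_continuousP => x Dx.
  apply: (@cvg_comp _ _ _ f phi); first exact: fD.
  exact: (is_C2_continuous phiC2).
have [d1 d10 hd1] := uniform_continuity D_compact fD delta4.
have [d2 d20 hd2] := uniform_continuity (W := R^o) D_compact phifD eps0.
have h0 : 0 < Num.min d1 d2 by rewrite lt_min d10.
have [I [psi [psi_cont psi01 psi_near psi1 psiN]]] := finite_cover D_compact h0.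
pose active k x := [/\ D x, psi k x != 0 & c - eps <= phi (f x)].
have exX k : exists y, (exists x, active k x) -> active k y.
  have [[x kx]|nk] := pselect (exists x, active k x); first by exists x.
  by exists 0.
have [X hX] := choice exX.
pose s := [seq k <- enum I | `[< exists x, active k x >]].
have s_active k : k \in s -> active k (X k).
  by rewrite mem_filter => /andP[/asboolP ex _]; exact: hX.
have countE x : (count (fun k => psi k x != 0%R) s <= 4 ^ n)%N.
  apply: leq_trans (psiN x); rewrite -size_filter cardE; apply: uniq_leq_size.
    by do 2 apply: filter_uniq; exact: enum_uniq.
  by move=> k; rewrite mem_filter mem_enum inE => /andP[].
have N0 : 0 < ((4 ^ n)%:R : R) by rewrite ltr0n expn_gt0.
pose s0 := eps / 2 / (4 ^ n)%:R.
have s00 : 0 < s0 by rewrite !divr_gt0.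
have s_ok k : k \in s -> [/\ b (f (X k)) (f (X k)) = mu, `|f (X k)| < r - 1,
    forall x, D x -> psi k x != 0 -> `|f x - f (X k)| <= delta / 4 &
    steep (f (X k)) eta \/ negative_frame (f (X k)) eta].
  move=> /s_active[DX kX hiX]; have [fr fdir] := f_high _ DX hiX.
  split=> //; first exact: fS.
  move=> x Dx kx; apply/ltW/hd1 => //.
  by have := psi_near _ _ _ kx kX; rewrite lt_min => /andP[].
have [g [gD hg]] := sequential_descent Nrho s00 fD fS psi_cont psi01 countE s_ok.
exists g; split => // x Dx; have /= [gS gf gphi] := hg x Dx.
split => //.
  move=> low; suff c0 : count (fun k => psi k x != 0%R) s = 0%N.
    by move: gf; rewrite c0 mul0r normr_le0 subr_eq0 => /eqP.
  apply/eqP; rewrite -leqn0 leqNgt -has_count; apply/hasP => -[k ks kx].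
  have [DX kX hiX] := s_active k ks.
  have := psi_near _ _ _ kx kX; rewrite lt_min => /andP[_ xX].
  by have := hd2 _ _ Dx DX xX; rewrite /= ltr_norml => /andP[]; lra.
have cs0 : (count (fun k => psi k x != 0%R) s)%:R * s0 <= eps / 2.
  rewrite /s0 mulrA ler_pdivrMr// mulrC ler_wpM2l ?ler_nat//.
  by rewrite divr_ge0// ltW.
have [hi|lo] := lerP (c - eps) (phi (f x)).
  have [k k1] := psi1 x Dx.
  have hask : has (fun k => psi k x == 1) s.
    apply/hasP; exists k; last by rewrite k1.
    rewrite mem_filter mem_enum andbT; apply/asboolP; exists x; split=> //.
    by rewrite k1 oner_neq0.
  by move: gphi (f_le x Dx); rewrite hask; lra.
have gain0 : 0 <= eta * rho ^+ 2 / 4 by apply: le_trans gain; rewrite mulr_ge0// ltW.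
by move: gphi; case: ifP => _; lra.
Qed.

End Sphere.

(** * Choice of the scales and conclusion *)

(** With [eta = eps `^ alpha1] and a displacement proportional to
    [eta `^ alpha^-1], on which the derivatives oscillate by [O(eta)], the gain is
    proportional to [eta `^ (1 + 2 / alpha)]. The bound on [alpha1] makes this at
    least of order [eps `^ (1 / 2)], which exceeds every multiple of [eps] when
    [eps] is small. *)
Lemma scale_choice (R : realType) (alpha alpha1 C c0 : R) :
  0 < alpha -> 0 < alpha1 <= alpha / (2 * (alpha + 2)) -> 0 < C -> 0 < c0 ->
  exists2 eps0 : R, 0 < eps0 & forall eps, 0 < eps < eps0 ->
    0 < eps `^ alpha1 <= 1 /\
    4 * eps <= c0 * (eps `^ alpha1 * ((eps `^ alpha1 / C) `^ alpha^-1) ^+ 2).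
Proof.
move=> a0 /andP[a10 a1le] C0 c00.
have C'0 : 0 < C^-1 `^ alpha^-1 by rewrite powR_gt0// invr_gt0.
pose c2 := c0 * (C^-1 `^ alpha^-1) ^+ 2.
have c20 : 0 < c2 by rewrite mulr_gt0// exprn_gt0.
exists (Num.min 1 ((c2 / 4) ^+ 2)).
  by rewrite lt_min ltr01 exprn_gt0// divr_gt0.
move=> eps /andP[e0]; rewrite lt_min => /andP[e1 ec].
have eta0 : 0 < eps `^ alpha1 by rewrite powR_gt0.
have eta1 : eps `^ alpha1 <= 1.
  have <- : (1 : R) `^ alpha1 = 1 by rewrite powR1.
  by apply: ge0_ler_powR; rewrite ?nnegrE ?ltW.
split; first by rewrite eta0.
rewrite powRM ?(ltW eta0) ?invr_ge0 ?(ltW C0)// exprMn.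
have -> : c0 * (eps `^ alpha1 * (((eps `^ alpha1) `^ alpha^-1) ^+ 2 * (C^-1 `^ alpha^-1) ^+ 2))
  = c2 * (eps `^ alpha1 * ((eps `^ alpha1) `^ alpha^-1) ^+ 2) by rewrite /c2; ring.
have exponent : alpha1 + (alpha1 * alpha^-1 + alpha1 * alpha^-1) <= 2^-1.
  have -> : alpha1 + (alpha1 * alpha^-1 + alpha1 * alpha^-1) = alpha1 * ((alpha + 2) / alpha).
    by field; rewrite gt_eqF.
  have a2 : 0 < (alpha + 2) / alpha by rewrite divr_gt0// addr_gt0.
  apply: le_trans (ler_wpM2r (ltW a2) a1le) _.
  suff -> : alpha / (2 * (alpha + 2)) * ((alpha + 2) / alpha) = 2^-1 by [].
  by field; rewrite !gt_eqF// addr_gt0.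
have epsn0 : eps != 0 by rewrite gt_eqF.
have -> : eps `^ alpha1 * ((eps `^ alpha1) `^ alpha^-1) ^+ 2 =
    eps `^ (alpha1 + (alpha1 * alpha^-1 + alpha1 * alpha^-1)).
  by rewrite -powRrM !powRD ?epsn0 ?implybT.
have : eps `^ 2^-1 <= eps `^ (alpha1 + (alpha1 * alpha^-1 + alpha1 * alpha^-1)).
  by apply: ger_powR exponent; rewrite e0 ltW.
rewrite (powR12_sqrt (ltW e0)) => he.
apply: (@le_trans _ _ (c2 * Num.sqrt eps)); last by rewrite ler_wpM2l// ltW.
rewrite -{1}(sqr_sqrtr (ltW e0)) expr2 mulrA ler_wpM2r ?sqrtr_ge0//.
suff : Num.sqrt eps <= c2 / 4 by lra.
rewrite -[leRHS]ger0_norm; last by rewrite divr_ge0// ltW.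
by rewrite -sqrtr_sqr ler_sqrt ?sqr_ge0// ltW.
Qed.

Lemma holder_constants (R : realType) (E : normedModType R) (dphi : E -> clin E R)
    (d2phi : E -> clin E (clin E R)) (alpha r mu : R) :
  0 < alpha -> 0 < r -> 0 < mu ->
  holder_on_bounded alpha dphi -> holder_on_bounded alpha d2phi ->
  exists L M : R, [/\ 1 <= L, mu^-1 <= L, r <= L & 1 <= M] /\
    [/\ forall u, `|u| < r -> `|dphi u| <= L /\ `|d2phi u| <= L &
        forall u v, `|u| < r -> `|v| < r ->
          `|dphi u - dphi v| <= M * `|u - v| `^ alpha /\
          `|d2phi u - d2phi v| <= M * `|u - v| `^ alpha].
Proof.
move=> a0 r0 mu0 /(_ r r0)[M1 M10 h1] /(_ r r0)[M2 M20 h2].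
have ballE (W : normedModType R) (u : W) : `|u| < r -> ball 0 r u.
  by move=> ur; rewrite -ball_normE /= sub0r normrN.
have ra : 0 <= r `^ alpha by exact: powR_ge0.
have M1r : 0 <= M1 * r `^ alpha by rewrite mulr_ge0// ltW.
have M2r : 0 <= M2 * r `^ alpha by rewrite mulr_ge0// ltW.
have mui : 0 <= mu^-1 by rewrite invr_ge0 ltW.
exists (1 + r + mu^-1 + `|dphi 0| + `|d2phi 0| + M1 * r `^ alpha + M2 * r `^ alpha),
  (1 + M1 + M2).
have n1 := normr_ge0 (dphi 0); have n2 := normr_ge0 (d2phi 0).
split; first by split; lra.
split.
  move=> u ur.
  have ua : `|u| `^ alpha <= r `^ alpha.
    by apply: ge0_ler_powR; rewrite ?nnegrE// ltW.
  have u0r : ball (0 : E) r 0 by apply: ballE; rewrite normr0.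
  have := h1 u 0 (ballE _ u ur) u0r; have := h2 u 0 (ballE _ u ur) u0r.
  rewrite subr0 => k2 k1; split.
    rewrite -(subrK (dphi 0) (dphi u)); apply: le_trans (ler_normD _ _) _.
    have : M1 * `|u| `^ alpha <= M1 * r `^ alpha by rewrite ler_wpM2l// ltW.
    by move: k1; lra.
  rewrite -(subrK (d2phi 0) (d2phi u)); apply: le_trans (ler_normD _ _) _.
  have : M2 * `|u| `^ alpha <= M2 * r `^ alpha by rewrite ler_wpM2l// ltW.
  by move: k2; lra.
move=> u v ur vr; split.
  by apply: le_trans (h1 u v (ballE _ u ur) (ballE _ v vr)) _;
    rewrite ler_wpM2r ?powR_ge0//; lra.
by apply: le_trans (h2 u v (ballE _ u ur) (ballE _ v vr)) _;
  rewrite ler_wpM2r ?powR_ge0//; lra.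
Qed.

Lemma norm_on_gt_steep (R : realType) (E : normedModType R) (b : E -> E -> R)
    (dphi : E -> clin E R) (u : E) (eta : R) :
  (forall k v w, b u (k *: v + w) = k * b u v + b u w) ->
  3 * eta < norm_on [set v | b u v = 0] (dphi u) -> steep b dphi u eta.
Proof.
move=> b_lin /sup_gt -[|_ [v [/= uv v1] <-] hv].
  exists `|dphi u 0|, 0 => //; split=> /=; last by rewrite normr0.
  by have := b_lin (-1) 0 0; rewrite scaler0 addr0 mulN1r addNr.
have [dv|dv] := lerP (dphi u v) 0.
  by exists v; split=> //; move: hv; rewrite ler0_norm//; lra.
exists (- v); split; rewrite ?normrN//.
  have b00 : b u 0 = 0.
    by have := b_lin (-1) 0 0; rewrite scaler0 addr0 mulN1r addNr.
  by have := b_lin (-1) v 0; rewrite scaleN1r addr0 uv b00 mulr0 addr0.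
by rewrite linearN; move: hv; rewrite gtr0_norm//; lra.
Qed.

Lemma lin_indep_widen (R : realType) (E : normedModType R) m k (mk : (m <= k)%N)
    (w : 'I_k -> E) : lin_indep w -> lin_indep (w \o widen_ord mk).
Proof.
move=> w_free a a0 i.
(* Extension of the coefficients by 0. *)
pose a' (j : 'I_k) := oapp a 0 (insub (j : nat) : option 'I_m).
have a'E j : a' (widen_ord mk j) = a j.
  by rewrite /a' /=; case: insubP => [j' _ jj'|]; [congr (a _); exact: val_inj|rewrite ltn_ord].
rewrite -a'E; apply: w_free.
rewrite (bigID (fun j : 'I_k => (j < m)%N))/= [X in _ + X]big1 ?addr0; last first.
  by move=> j jm; rewrite /a' insubN// scale0r.
rewrite big_ord_narrow -[RHS]a0; apply: eq_bigr => j _.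
by rewrite a'E.
Qed.

Lemma not_dim_le_frame (R : realType) (E : normedModType R) (b : E -> E -> R)
    (dphi : E -> clin E R) (d2phi : E -> clin E (clin E R)) n (u : E) (eta : R)
    (W : set E) :
  submod_closed (mem W) -> W `<=` [set v | b u v = 0] ->
  (forall w, W w -> w != 0 -> sphere_hessian b dphi d2phi u w w < - eta * `|w| ^+ 2) ->
  b 0 0 = 0 -> ~ dim_le W n -> negative_frame b dphi d2phi n u eta.
Proof.
move=> [W0 Wlin] Wtan Wneg b00 /existsNP[k /existsNP[w /not_implyP[wW /not_implyP[w_free /negP]]]].
rewrite -ltnNge => nk.
exists (w \o widen_ord nk); split; first exact: lin_indep_widen.
move=> a /=; set v := \sum_i _.
have Wv : W v.
  suff : v \in mem W by rewrite inE.
  rewrite /v; elim/big_rec: _ => // j y _ yW.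
  by apply: Wlin => //; rewrite inE; exact: wW.
split; first exact: Wtan.
have [v0|/(Wneg v Wv)/ltW//] := eqVneq v 0.
by rewrite v0 /sphere_hessian linear0 b00 normr0 expr0n !mulr0 subrr.
Qed.

Theorem theorem2p1 (R : realType) (E H : completeNormedModType R)
  (ipE : {dot E for (@idfun R)}) (ipH : {dot H for (@idfun R)})
  (hilbE : hilbert_product ipE) (hilbH : hilbert_product ipH)
  (infE : infinite_dim E) (infH : infinite_dim H)
  (i : {linear E -> H}) (hi : gelfand_triple ipH i)
  (mu : R) (mu_gt0 : 0 < mu)
  (phi : E -> R) (dphi : E -> clin E R) (d2phi : E -> clin E (clin E R))
  (phiC2 : is_C2 phi dphi d2phi)
  (alpha : R) (halpha : 0 < alpha <= 1)
  (dphi_holder : holder_on_bounded alpha dphi)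
  (d2phi_holder : holder_on_bounded alpha d2phi)
  (n : nat) (B : set E) (F : set (set E))
  (hF : homotopic_family (sphere ipH i mu) n B F)
  (c : R) (hc : minimax phi F = c%:E) (hB : (max_on phi B < c%:E)%E)
  (r alpha1 : R) (hr : 1 < r)
  (halpha1 : 0 < alpha1 <= alpha / (2 * (alpha + 2))) :
  exists2 eps0 : R, 0 < eps0 &
    forall eps : R, 0 < eps < eps0 ->
    forall A : set E, F A -> (max_on phi A <= (c + eps)%:E)%E ->
      [set u | A u /\ c - eps <= phi u] `<=` ball 0 (r - 1) ->
      exists2 u_eps : E, sphere ipH i mu u_eps &
        [/\ c - eps <= phi u_eps <= c + eps,
            sphere_diff_norm ipH i dphi u_eps <= 3 * eps `^ alpha1,
            A u_eps &
            forall W : set E,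
              submod_closed (mem W) -> W `<=` tangent ipH i u_eps ->
              (forall w, W w -> w != 0 ->
                D2 ipH i dphi d2phi u_eps w w < - eps `^ alpha1 * `|w| ^+ 2) ->
              dim_le W n].
Proof.
pose b (u v : E) := ipH (i u) (i v).
have [_ i_le _] := hi.
have b_lin k u v w : b (k *: u + v) w = k * b u w + b v w.
  by rewrite /b linearP linearPl.
have b_sym u v : b u v = b v u.
  by rewrite /b hermC /= expr0 mul1r.
have formr k u v w : b u (k *: v + w) = k * b u v + b u w by exact: form_linr.
have normE u : `|i u| ^+ 2 = b u u by exact: hilbH.
have b_ge0 u : 0 <= b u u by rewrite -normE sqr_ge0.
have b_le u v : `|b u v| <= `|u| * `|v|.
  have i_cs : `|b u v| <= `|i u| * `|i v|.
    (* Cauchy-Schwarz in [H] from the triangle inequality, for both signs of [s]. *)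
  have polar (s : R) : s ^+ 2 = 1 -> 4 * (s * b u v) <= 4 * (`|i u| * `|i v|).
      move=> s1.
      have n1 : `|s| = 1 by apply/eqP; rewrite -sqrp_eq1// real_normK ?num_real// s1.
      have e1 : b (s *: u + v) (s *: u + v) = b u u + 2 * (s * b u v) + b v v.
        by rewrite b_lin !formr (b_sym v u) !mulrDr mulrA -expr2 s1; ring.
      have e2 : `|i (s *: u + v)| ^+ 2 <= (`|i u| + `|i v|) ^+ 2.
        rewrite lerXn2r ?nnegrE ?addr_ge0//.
        by rewrite linearP (le_trans (ler_normD _ _))// normrZ n1 mul1r.
      move: e2; rewrite normE e1 sqrrD !normE; lra.
    have := polar 1 (expr1n _ _); have := polar (-1) (etrans (sqrrN 1) (expr1n R 2)).
    by rewrite ler_norml; lra.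
  by apply: le_trans i_cs _; apply: ler_pM.
have [alpha0 alpha1_le] := andP halpha.
have r0 : 0 < r by lra.
have [L [M [[L1 muL rL M1] [bounds holder]]]] :=
  holder_constants alpha0 r0 mu_gt0 dphi_holder d2phi_holder.
have [D [D0 [eta0 [D_compact [D0_closed D0D] eta0_cont eta0B FE]]]] := hF.
have L0 : 0 < L := lt_le_trans ltr01 L1.
have M0 : 0 < M := lt_le_trans ltr01 M1.
pose N : R := (4 ^ n)%:R.
have N1 : 1 <= N by rewrite ler1n expn_gt0.
have N0 : 0 < N := lt_le_trans ltr01 N1.
(* [C] turns the smallness of [om] required by the local moves into an equality:
   with [y = eta / C] and [delta `^ alpha = y], [200 * L ^+ 9 * om = eta]. *)
pose C := 200 * L ^+ 9 * M.
have L9 : 1 <= L ^+ 9 by rewrite exprn_ege1.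
have C1 : 1 <= C.
  rewrite /C -[1]mulr1; apply: ler_pM => //; rewrite -[1]mulr1.
  by apply: ler_pM => //; lra.
have C0 : 0 < C := lt_le_trans ltr01 C1.
(* At most [N] moves of length [4 * L ^+ 2 * (delta / q)] add up to [delta / 4]. *)
pose q := 16 * N * L ^+ 2.
have q0 : 0 < q by rewrite !mulr_gt0// exprn_gt0.
have cst0 : 0 < (q ^+ 2)^-1 / 4 by rewrite divr_gt0// invr_gt0 exprn_gt0.
have [e1 e10 scale] := scale_choice alpha0 halpha1 C0 cst0.
have [e2 e20 boundary] : exists2 e2, 0 < e2 & forall u, B u -> phi u <= c - e2.
  case E0 : (max_on phi B) hB => [m| |] //= mc.
    exists (c - m); first by rewrite subr_gt0 -lte_fin.
    move=> u Bu; rewrite opprB addrC subrK -lee_fin -E0.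
    by apply: ereal_sup_ubound; exists u.
  exists 1 => // u Bu.
  have : ((phi u)%:E <= max_on phi B)%E by apply: ereal_sup_ubound; exists u.
  by rewrite E0.
(* [eps < e2 / 2] puts the boundary below the level [c - 2 * eps], where the
   deformation is the identity. *)
exists (Num.min e1 (e2 / 2)); first by rewrite lt_min e10 divr_gt0.
move=> eps /andP[eps0]; rewrite lt_min => /andP[eps1 eps2] A FA A_le K_ball.
apply: contrapT => none.
have [/andP[eta_gt0 eta_le1] gain] := scale eps (introT andP (conj eps0 eps1)).
set eta := eps `^ alpha1 in eta_gt0 eta_le1 gain none.
pose y := eta / C.
have y0 : 0 < y by rewrite divr_gt0.
have y1 : y <= 1 by rewrite ler_pdivrMr// mul1r; exact: le_trans C1.
pose delta := y `^ alpha^-1; pose om := M * y.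
have delta0 : 0 < delta by rewrite powR_gt0.
have deltaE : delta `^ alpha = y.
  by rewrite /delta -powRrM mulVf ?gt_eqF// powRr1// ltW.
have delta_y : delta <= y.
  rewrite -[leRHS](powRr1 (ltW y0)); apply: ger_powR; first by rewrite y0.
  by rewrite invf_ge1.
have delta_om : delta <= om by apply: le_trans delta_y _; rewrite ler_peMl// ltW.
have om_eta : 200 * L ^+ 9 * om = eta.
  by rewrite /om /y mulrA -/C mulrC divfK ?gt_eqF.
have om_le1 : om <= 1.
  have om0 : 0 <= om by rewrite mulr_ge0// ltW.
  have : om <= L ^+ 9 * om by rewrite ler_peMl.
  by move: om_eta; lra.
pose rho := delta / q.
have rho0 : 0 < rho by rewrite divr_gt0.
have Nrho : N * (4 * L ^+ 2 * rho) = delta / 4.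
  by rewrite /rho /q; field; rewrite !gt_eqF// exprn_gt0.
have rho_delta : 4 * L ^+ 2 * rho <= delta / 4.
  rewrite -Nrho ler_peMl// ltW// mulr_gt0// mulr_gt0// exprn_gt0//.
have gain' : 4 * eps <= eta * rho ^+ 2 / 4.
  apply: le_trans gain _; rewrite le_eqVlt; apply/orP; left; apply/eqP.
  rewrite -/y -/delta /rho; field.
  by rewrite gt_eqF.
have modulus u v : `|u| < r -> `|v| < r -> `|u - v| <= delta ->
    `|dphi u - dphi v| <= om /\ `|d2phi u - d2phi v| <= om.
  move=> ur vr uv; have [h1 h2] := holder u v ur vr.
  have : M * `|u - v| `^ alpha <= om.
    rewrite /om ler_pM2l// -deltaE; apply: ge0_ler_powR; rewrite ?nnegrE//.
      exact: ltW.
    exact: ltW.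
  by move=> h; split; [exact: le_trans h1 h|exact: le_trans h2 h].
have [AS [f [fD fD0 AE]]] : A `<=` sphere ipH i mu /\ exists f : 'rV[R]_n -> E,
    [/\ {within D, continuous f}, forall x, D0 x -> f x = eta0 x & A = f @` D].
  by move: FA; rewrite FE.
have fA x : D x -> A (f x) by move=> Dx; rewrite AE; exists x.
have fS x : D x -> b (f x) (f x) = mu by move=> /fA/AS.
have f_le x : D x -> phi (f x) <= c + eps.
  move=> /fA Afx; rewrite -lee_fin; apply: le_trans A_le.
  by apply: ereal_sup_ubound; exists (f x).
have f_high x : D x -> c - eps <= phi (f x) -> `|f x| < r - 1 /\
    (steep b dphi (f x) eta \/ negative_frame b dphi d2phi n (f x) eta).
  move=> Dx hi_x; have Afx := fA x Dx; split.
    have := K_ball (f x) (conj Afx hi_x).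
    by rewrite -ball_normE /= sub0r normrN.
  have [small|big] := lerP (sphere_diff_norm ipH i dphi (f x)) (3 * eta); last first.
    by left; apply: norm_on_gt_steep big => k v w; exact: formr.
  right; apply: contrapT => noframe; apply: none; exists (f x); first exact: AS.
  split => //; first by rewrite hi_x f_le.
  move=> W Wsub Wtan Wneg; apply: contrapT => Wdim; apply: noframe.
  apply: not_dim_le_frame Wsub Wtan Wneg _ Wdim.
  by rewrite /b !linear0.
have om_eta_le : 200 * L ^+ 9 * om <= eta by rewrite om_eta.
have Nrho_le : N * (4 * L ^+ 2 * rho) <= delta / 4 by rewrite Nrho.
have [g [gD hg]] := push_below b_lin b_sym b_ge0 b_le mu_gt0 phiC2 D_compact L1 muL
  rL bounds modulus delta_om om_le1 om_eta_le eta_le1 rho0 rho_delta Nrho_le eps0 gain' fD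
  fS f_le f_high.
have Fg : F (g @` D).
  rewrite FE; split; first by move=> _ [x Dx <-]; have [] := hg x Dx.
  exists g; split => // x D0x; have Dx := D0D x D0x.
  have [_ gf _] := hg x Dx; rewrite gf; first exact: fD0.
  have : phi (f x) <= c - e2.
    by rewrite fD0//; apply: boundary; rewrite -eta0B; exists x.
  lra.
have : (minimax phi F <= max_on phi (g @` D))%E.
  by apply: ereal_inf_lbound; exists (g @` D).
apply/negP; rewrite -ltNge hc; apply: (@le_lt_trans _ _ (c - eps / 2)%:E).
  apply: ge_ereal_sup => _ [_ [x Dx <-] <-]; rewrite lee_fin.
  by have [] := hg x Dx.
by rewrite lte_fin; lra.
Qed.
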